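(* Let $0<L<\sqrt{3}\,\pi$. Suppose that there are positive constants $M$ and $d<1$ such that $0<\tau(0)\le\tau(t)\le M$ and $\dot\tau(t)\le d<1$ for all $t\ge0$, and $\tau\in W^{2,\infty}([0,T])$ for $T>0$. Suppose also that the feedback gains $\alpha,\beta$ satisfy $(2\alpha-|\beta|)(1-d)>|\beta|$. Then, for two positive constants $\mu_1$ and $\mu_2$ with $\mu_1L<1$, there exist $$\zeta=\frac{1+\max\{\mu_1L,\mu_2\}}{1-\max\{\mu_1L,\mu_2\}}$$ and $$\lambda\le\min\left\{\frac{\mu_1(3\pi^2-L^2)}{L^2(1+\mu_1)},\ \frac{\mu_2(1-d)}{M(1+\mu_2)}\right\}$$ such that the energy $$E(t)=\frac12\int_0^L\big(\eta^2(t,x)+\omega^2(t,x)\big)\,dx+\frac{|\beta|}{2}\,\tau(t)\int_0^1\eta_x^2(t-\tau(t)\rho,L)\,d\rho$$ associated with the linearized (around the origin) KdV-KdV system with time-varying boundary delay described in the context satisfies $$E(t)\le\zeta\,E(0)\,e^{-\lambda t}\qquad\text{for all }t\ge0.$$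
   Context: The linearized KdV-KdV system with time-varying boundary delay $\tau(t)$ and real feedback gains $\alpha,\beta$ is $$\begin{cases} \eta_t+\omega_x+\omega_{xxx}=0,\quad \omega_t+\eta_x+\eta_{xxx}=0, & t>0,\ x\in(0,L),\\ \eta(t,0)=\eta(t,L)=\eta_x(t,0)=\omega(t,0)=\omega(t,L)=0,& t>0,\\ \omega_x(t,L)=-\alpha\,\eta_x(t,L)+\beta\,\eta_x(t-\tau(t),L),& t>0,\\ \eta_x(t-\tau(0),L)=z_0(t-\tau(0)),& 0<t<\tau(0),\\ (\eta(0,x),\omega(0,x))=(\eta_0(x),\omega_0(x)),& x\in(0,L). \end{cases}$$ It is obtained from the nonlinear system (whose equations have the additional terms $(\eta\omega)_x$ in the first equation and $\omega\omega_x$ in the second) by dropping the nonlinear terms. The initial data satisfy $(\eta_0,\omega_0)\in L^2(0,L)\times L^2(0,L)$ and $z_0(-\tau(0)\,\cdot)\in L^2(0,1)$. Setting $z(t,\rho)=\eta_x(t-\tau(t)\rho,L)$, $\rho\in(0,1)$, the system is the Cauchy problem $U'(t)=A(t)U(t)$, $U(0)=(\eta_0,\omega_0,z_0(-\tau(0)\,\cdot))$, for $U=(\eta,\omega,z)$ in $H=L^2(0,L)\times L^2(0,L)\times L^2(0,1)$, where $$A(t)(\eta,\omega,z)=\Big(-\omega_x-\omega_{xxx},\ -\eta_x-\eta_{xxx},\ \tfrac{\dot\tau(t)\rho-1}{\tau(t)}z_\rho\Big)$$ with domain the set of $(\eta,\omega,z)\in[H^3(0,L)\cap H^1_0(0,L)]^2\times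 H^1(0,1)$ such that $\eta_x(0)=0$, $z(0)=\eta_x(L)$, $\omega_x(L)=-\alpha\eta_x(L)+\beta z(1)$. *)

(* Defs.v *)
From mathcomp Require Import all_boot all_order all_algebra.
From mathcomp Require Import all_classical all_reals all_analysis.
Import Order.TTheory GRing.Theory Num.Theory.
Import numFieldNormedType.Exports.

Set Implicit Arguments.
Unset Strict Implicit.
Unset Printing Implicit Defensive.

Local Open Scope classical_set_scope.
Local Open Scope ring_scope.

(* Elements of L^p(a,b) are represented by total functions R -> R of which only
   the restriction to ]a, b[ matters. *)
Definition Lp {R : realType} (p : \bar R) (a b : R) (f : R -> R) : Prop :=
  (f \_ `]a, b[%classic) \in Lfun (@lebesgue_measure R) p.

(* f is in W^{1,p}(a,b) with weak derivative g, and f is its representative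
   continuous on [a, b]: in dimension one W^{1,p}(a,b) consists of the primitives
   of L^p functions.  The boundary values f a and f b are thus the traces. *)
Definition sobolev_derivative {R : realType} (p : \bar R) (a b : R)
    (f g : R -> R) : Prop :=
  Lp p a b g /\
  forall x, a <= x <= b ->
    f x = f a + \int[@lebesgue_measure R]_(y in `]a, x[) g y.

(* f is in H^3(a,b) with successive derivatives f1, f2, f3; f, f1, f2 are the
   continuous representatives. *)
Definition H3_derivatives {R : realType} (a b : R) (f f1 f2 f3 : R -> R) : Prop :=
  [/\ sobolev_derivative 2%:E a b f f1,
      sobolev_derivative 2%:E a b f1 f2 &
      sobolev_derivative 2%:E a b f2 f3].

(* tau is in W^{2,oo}(a,b) and dtau is the continuous representative of its
   derivative. *)
Definition W2oo {R : realType} (a b : R) (tau dtau : R -> R) : Prop :=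
  sobolev_derivative +oo%E a b tau dtau /\
  exists ddtau : R -> R, sobolev_derivative +oo%E a b dtau ddtau.

(* (eta, omega, z), with z(t, rho) = eta_x(t - tau(t) rho, L) *)
Definition state (R : realType) : Type :=
  ((R -> R^o) * (R -> R^o) * (R -> R^o))%type.

Section KdVKdV.
Context {R : realType}.
Implicit Types (L alpha beta t : R) (tau dtau : R -> R) (U : R -> state R).

(* H = L^2(0,L) x L^2(0,L) x L^2(0,1) *)
Definition inH L (u : state R) : Prop :=
  [/\ Lp 2%:E 0 L u.1.1, Lp 2%:E 0 L u.1.2 & Lp 2%:E 0 1 u.2].

Definition sqnormH L (u : state R) : R :=
  \int[@lebesgue_measure R]_(x in `]0, L[) (u.1.1 x ^+ 2 + u.1.2 x ^+ 2) +
  \int[@lebesgue_measure R]_(rho in `]0, 1[) (u.2 rho ^+ 2).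

(* The graph of A(t): u is in D(A(t)) and v = A(t) u.  The third derivatives and
   z1 are determined up to null sets only, hence so is v. *)
Definition generator L alpha beta tau dtau t (u v : state R) : Prop :=
  let: (eta, omega, z) := u in
  exists eta1 eta2 eta3 omega1 omega2 omega3 z1 : R -> R,
    [/\ [/\ H3_derivatives 0 L eta eta1 eta2 eta3,
            H3_derivatives 0 L omega omega1 omega2 omega3 &
            sobolev_derivative 2%:E 0 1 z z1],
        [/\ eta 0 = 0, eta L = 0, omega 0 = 0 & omega L = 0],
        [/\ eta1 0 = 0, z 0 = eta1 L &
            omega1 L = - alpha * eta1 L + beta * z 1] &
        v = (fun x => - omega1 x - omega3 x,
             fun x => - eta1 x - eta3 x,
             fun rho => (dtau t * rho - 1) / tau t * z1 rho)].

(* U is continuous on [0, +oo[ with values in H and, for every t > 0, U(t) is in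
   D(A(t)) and U is differentiable at t in H with U'(t) = A(t) U(t). *)
Definition classical_solution L alpha beta tau dtau U : Prop :=
  [/\ forall t, 0 <= t -> inH L (U t),
      forall t, 0 <= t ->
        sqnormH L (U s - U t) @[s --> within [set s | 0 <= s] (nbhs t)]
          --> (0 : R) &
      forall t, 0 < t -> exists2 v : state R,
        generator L alpha beta tau dtau t (U t) v &
        sqnormH L (h^-1 *: (U (t + h) - U t) - v) @[h --> (0 : R)^'] --> (0 : R)].

(* Solution of U' = A(t) U, U(0) = u0 for data u0 in H.  The evolution family
   generated by A(t) is the extension by density from the domain to H, so that
   its trajectories are the limits in H, uniformly on bounded time intervals, of
   classical solutions. *)
Definition mild_solution L alpha beta tau dtau (u0 : state R) U : Prop :=
  [/\ forall t, 0 <= t -> inH L (U t),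
      sqnormH L (U 0 - u0) = 0 &
      exists2 Un : nat -> R -> state R,
        forall n, classical_solution L alpha beta tau dtau (Un n) &
        forall T e : R, 0 < T -> 0 < e ->
          \forall n \near \oo, forall t, 0 <= t <= T ->
            sqnormH L (Un n t - U t) <= e].

Definition energy L beta tau U t : R :=
  2^-1 * \int[@lebesgue_measure R]_(x in `]0, L[)
           ((U t).1.1 x ^+ 2 + (U t).1.2 x ^+ 2) +
  `|beta| / 2 * tau t *
    \int[@lebesgue_measure R]_(rho in `]0, 1[) ((U t).2 rho ^+ 2).

Definition exponential_decay L alpha beta tau dtau (zeta lambda : R) : Prop :=
  forall (eta0 omega0 z0 : R -> R) U,
    let u0 : state R := (eta0, omega0, fun rho => z0 (- tau 0 * rho)) in
    inH L u0 ->
    mild_solution L alpha beta tau dtau u0 U ->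
    forall t, 0 <= t ->
      energy L beta tau U t
        <= zeta * energy L beta tau U 0 * expR (- (lambda * t)).

Definition decay_constant L (mu1 mu2 : R) : R :=
  (1 + Num.max (mu1 * L) mu2) / (1 - Num.max (mu1 * L) mu2).

Definition decay_rate L (M d mu1 mu2 : R) : R :=
  Num.min (mu1 * (3 * pi ^+ 2 - L ^+ 2) / (L ^+ 2 * (1 + mu1)))
          (mu2 * (1 - d) / (M * (1 + mu2))).

End KdVKdV.

(* Main.v *)
Require Import Defs.
From mathcomp Require Import all_boot all_order all_algebra.
From mathcomp Require Import all_classical all_reals all_analysis.
From mathcomp Require Import measurable_realfun ess_sup_inf.
From mathcomp Require Import ring lra.
Import Order.TTheory GRing.Theory Num.Theory.
Import numFieldNormedType.Exports.

(** The Lyapunov functional is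
      V = 1/2 int (eta^2 + omega^2) + mu1 int x eta omega
          + |beta|/2 tau int (1 + mu2 (1 - rho)) z^2,
    which differs from the energy E by a factor between 1 - m and 1 + m with
    m = max(mu1 L, mu2).  Along a classical solution, integration by parts turns
    V' into a quadratic form in (eta_x(t,L), z(t,1)), which the condition on the
    gains makes nonpositive for small mu1 and mu2, minus
      mu1 (3/2 int (eta_x^2 + omega_x^2) - 1/2 int (eta^2 + omega^2)) and
      mu2 |beta|/2 int (1 - tau' rho) z^2.
    The Wirtinger inequality int eta_x^2 >= (pi/L)^2 int eta^2 makes the first
    positive for L < sqrt 3 pi, so that V' <= - lambda V.  The estimate for E passes
    to the limit in H for mild solutions. *)

Set Implicit Arguments.
Unset Strict Implicit.
Unset Printing Implicit Defensive.

Local Open Scope classical_set_scope.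
Local Open Scope ring_scope.

(** * Product rule for absolutely continuous functions *)

Section ibp.
Context {R : realType}.
Notation mu := (@lebesgue_measure R).
Implicit Types (a b x : R) (f g u v : R -> R).

(** The derivative of the energy alone contains only the boundary values [eta_x(t,L)] and [z(t,1)],
    hence the corrections. The mixed product [x eta omega] is dictated by the coupling: since
    [eta_t] involves only [omega] and conversely, differentiating it gives two integrals of the
    single-function type [x f (- f_x - f_xxx)], each of which yields [- 3/2 int f_x^2]. The weight
    [1 + mu2 (1 - rho)] does the same for the transport equation of [z]. Regularity shapes the rest.
    Third derivatives exist only in L^2, so integrations by parts are carried out on primitives of
    integrable functions, with a product rule drawn from Fubini. In time a solution is
    differentiable only in the norm of H and only for t > 0; therefore V is differentiated as a
    combination of bilinear forms, and Gronwall's lemma asks for no more than right continuity at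
    0. *)

Lemma itv_oo_cc_integrable a b f :
  mu.-integrable `[a, b] (EFin \o f) <-> mu.-integrable `]a, b[ (EFin \o f).
Proof.
split; first by apply: integrableS => //; exact: subset_itv_oo_cc.
move=> /integrableP[mf fi]; apply/integrableP; split.
  exact/emeasurable_fun_itv_bndo_bndcP/emeasurable_fun_itv_obnd_cbndP.
rewrite integral_itv_bndoo//; exact: measurableT_comp.
Qed.

(** Real-valued indicator of a half-plane: as a factor of the integrand it turns inner integrals
    with a variable endpoint into integrals over the whole line, so that Fubini applies to a product
    space. *)
Definition ltind (z : R * R) : R := (z.2 < z.1)%R%:R.

Lemma measurable_ltind : measurable_fun setT ltind.
Proof.
apply: (measurableT_comp (f := fun b : bool => b%:R : R)) => //.
exact: measurable_fun_ltr.
Qed.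

Let tri u v (z : R * R) : \bar R := (u z.1 * v z.2 * ltind z)%:E.

Let integrable_tri u v :
  mu.-integrable setT (EFin \o u) -> mu.-integrable setT (EFin \o v) ->
  (mu \x mu)%E.-integrable setT (tri u v).
Proof.
move=> ui vi.
have mu_ : measurable_fun setT u by move/integrableP : ui => [/measurable_EFinP].
have mv_ : measurable_fun setT v by move/integrableP : vi => [/measurable_EFinP].
have mkr : measurable_fun setT (fun z : R * R => u z.1 * v z.2 * ltind z).
  apply: measurable_funM; last exact: measurable_ltind.
  by apply: measurable_funM; exact: measurableT_comp.
have mk : measurable_fun setT (tri u v) by exact/measurable_EFinP.
apply/integrable12ltyP => //.
(* As [ltind] is at most 1, the kernel is dominated by [|u x| |v y|], whose iterated integral is a
   product of two finite norms. *)
apply: (@le_lt_trans _ _ (\int[mu]_x (`|u x|%:E * \int[mu]_y `|v y|%:E)))%E.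
  apply: ge0_le_integral => //.
  - by move=> x _; exact: integral_ge0.
  - apply: (@measurable_fun_fubini_tonelli_F _ _ _ _ _ mu (abse \o tri u v)) => //=.
    exact: measurableT_comp.
  - apply: emeasurable_funM => //.
    apply/measurable_EFinP; exact: measurableT_comp.
  - move=> x _; rewrite -ge0_integralZl//; last first.
      apply/measurable_EFinP; exact: measurableT_comp.
    apply: ge0_le_integral => //.
    + apply/measurable_EFinP; apply: measurableT_comp => //.
      exact: (measurableT_comp mkr (measurable_pair1 x)).
    + under eq_fun do rewrite -EFinM.
      apply/measurable_EFinP; apply: (measurable_funM (measurable_cst _)).
      exact: measurableT_comp.
    + move=> y _; rewrite /tri/= -EFinM lee_fin !normrM ler_piMr//.
      by rewrite /ltind normr_nat; case: (_ < _)%R.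
move/integrableP : vi => [_ vi]; move/integrableP : ui => [_ ui].
rewrite -[X in (\int[mu]_x (_ * X) < _)%E]fineK; last first.
  by rewrite ge0_fin_numE//; exact: integral_ge0.
rewrite ge0_integralZr//.
- by rewrite muleC lte_mul_pinfty// lee_fin fine_ge0//; exact: integral_ge0.
- apply/measurable_EFinP; exact: measurableT_comp.
- by rewrite lee_fin fine_ge0//; exact: integral_ge0.
Qed.

(** The flag [c] selects which coordinate is frozen at [t]; both sections of the indicator occur in
    Fubini's theorem. *)
Let integrable_ltind (c : bool) v t :
  mu.-integrable setT (EFin \o v) ->
  mu.-integrable setT
    (fun s => (v s * ltind (if c then (t, s) else (s, t)))%:E).
Proof.
move=> vi; apply: (le_integrable _ _ _ vi) => //.
  move/integrableP : vi => [/measurable_EFinP mv _].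
  apply/measurable_EFinP; apply: measurable_funM => //.
  case: c; [exact: (measurableT_comp measurable_ltind (measurable_pair1 t))|
            exact: (measurableT_comp measurable_ltind (measurable_pair2 t))].
move=> s _; rewrite /= lee_fin normrM ler_piMr//.
by rewrite /ltind normr_nat; case: (_ < _)%R.
Qed.

(* Fubini on the triangle s < t: the two iterated integrals cover the plane up to
   the diagonal, which is a null set. *)
Lemma Rintegral_triangle u v :
  mu.-integrable setT (EFin \o u) -> mu.-integrable setT (EFin \o v) ->
  mu.-integrable setT (fun t => (u t * \int[mu]_s (v s * ltind (t, s)))%:E) /\
  \int[mu]_t (u t * \int[mu]_s (v s * ltind (t, s))) +
  \int[mu]_t (v t * \int[mu]_s (u s * ltind (t, s))) =
  (\int[mu]_t u t) * (\int[mu]_t v t).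
Proof.
move=> ui vi.
have FE p q : mu.-integrable setT (EFin \o p) -> mu.-integrable setT (EFin \o q) ->
    fubini_F mu (tri p q) =
    (fun t => (p t * \int[mu]_s (q s * ltind (t, s)))%:E).
  move=> pi qi; apply/funext => t; rewrite /fubini_F /tri/=.
  under eq_integral do rewrite -mulrA EFinM.
  have iq := integrable_ltind true t qi.
  rewrite integralZl// EFinM /Rintegral fineK//; exact: integrable_fin_num.
have FI p q : mu.-integrable setT (EFin \o p) -> mu.-integrable setT (EFin \o q) ->
    mu.-integrable setT (fun t => (p t * \int[mu]_s (q s * ltind (t, s)))%:E).
  by move=> pi qi; rewrite -FE//; apply: integrable_fubini_F; exact: integrable_tri.
split; first exact: FI.
have GE : fubini_G mu (tri u v) =
    (fun s => (v s * (\int[mu]_t u t - \int[mu]_t (u t * ltind (s, t))))%:E).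
  apply/funext => s; rewrite /fubini_G /tri/=.
  have iu := integrable_ltind false s ui.
  transitivity (\int[mu]_t ((v s)%:E * (u t * ltind (t, s))%:E))%E.
    by apply: eq_integral => t _; rewrite -EFinM mulrCA mulrA.
  rewrite integralZl// EFinM; congr (_ * _)%E.
  rewrite -RintegralB//; last exact: (integrable_ltind true).
  rewrite /Rintegral fineK; last first.
    apply: integrable_fin_num => //.
    rewrite (_ : (fun x => _) = (fun t => (u t)%:E - (u t * ltind (s, t))%:E)%E)//.
    by apply: integrableB => //; exact: (integrable_ltind true).
  apply: ae_eq_integral => //.
  - by move/integrableP : iu => [].
  - apply/measurable_EFinP; apply: measurable_funB.
      by move/integrableP : ui => [/measurable_EFinP].
    by move/integrableP : (integrable_ltind true s ui) => [/measurable_EFinP].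
  exists [set s]; split => //; first exact: lebesgue_measure_set1.
  move=> t /= /not_implyP[_] h; apply: contrapT => ts; apply: h.
  rewrite /ltind/=; congr EFin.
  by have [st|st|st] := ltgtP s t; rewrite ?mulr1 ?mulr0 ?subr0 ?subrr//; case: ts.
have := Fubini (integrable_tri ui vi).
rewrite -/(fubini_F mu (tri u v)) -/(fubini_G mu (tri u v)).
rewrite FE// GE => FG.
rewrite [X in X + _]/Rintegral FG -/(Rintegral mu setT _).
rewrite -RintegralD//; last 2 first.
- rewrite (_ : _ \o _ = (fun s => (\int[mu]_t u t)%:E * (v s)%:E -
     (v s * \int[mu]_t (u t * ltind (s, t)))%:E)%E); last first.
    by apply/funext => s /=; rewrite -EFinM -EFinB; congr EFin; ring.
  apply: integrableB => //; last exact: FI.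
  exact: integrableZl.
- exact: FI.
rewrite -RintegralZl//; apply: eq_Rintegral => s _; ring.
Qed.

End ibp.

(** * Absolutely continuous functions as primitives of integrable functions *)

Section ac.
Context {R : realType}.
Notation mu := (@lebesgue_measure R).
Implicit Types (a b x : R) (f g u v : R -> R).

(** Only an L^1 derivative is required: this is the common consequence of W^{1,2}, used in space,
    and of W^{1,oo}, used for the delay, and it suffices for the product rule. *)
Definition abscont a b f g : Prop :=
  mu.-integrable `]a, b[ (EFin \o g) /\
  forall x, a <= x <= b -> f x = f a + \int[mu]_(y in `]a, x[) g y.

Lemma integrable_itv_oo_sub a b x g : x <= b ->
  mu.-integrable `]a, b[ (EFin \o g) -> mu.-integrable `]a, x[ (EFin \o g).
Proof.
by move=> xb; apply: integrableS => //; apply: subset_itvl; rewrite bnd_simp.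
Qed.

Lemma abscont_within_continuous a b f g : a <= b -> abscont a b f g ->
  {within `[a, b], continuous f}.
Proof.
move=> ab [gi fE].
have gi' : mu.-integrable `[a, b] (EFin \o g) by exact/itv_oo_cc_integrable.
have c1 := parameterized_integral_continuous ab gi'.
apply: (@subspace_eq_continuous _ _ _
  (fun x => f a + parameterized_integral mu a x g)).
  move=> x /=; rewrite inE/= in_itv/= => axb; rewrite [RHS]fE//.
  congr (_ + _); rewrite /parameterized_integral /Rintegral.
  have /andP[_ xb] := axb.
  have /integrableP[mg _] := integrable_itv_oo_sub xb gi.
  by rewrite integral_itv_bndoo.
move=> x; apply: cvgD; first exact: cvg_cst.
exact: c1.
Qed.

Lemma abscont_bounded a b f g : abscont a b f g ->
  exists2 M, 0 <= M & forall x, a <= x <= b -> `|f x| <= M.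
Proof.
move=> [gi fE]; exists (`|f a| + \int[mu]_(y in `]a, b[) `|g y|).
  by rewrite addr_ge0// Rintegral_ge0.
move=> x /[dup] axb /andP[ax xb]; rewrite fE//.
rewrite (le_trans (ler_normD _ _))// lerD2l.
have gix := integrable_itv_oo_sub xb gi.
rewrite (le_trans (le_normr_Rintegral _ gix))//.
rewrite /Rintegral fine_le//.
- exact: integrable_fin_num (integrable_norm gix).
- exact: integrable_fin_num (integrable_norm gi).
- apply: ge0_subset_integral => //.
  + by move/integrable_norm : gi => /integrableP[].
  + by apply: subset_itvl; rewrite bnd_simp.
Qed.

Lemma abscont_measurable a b f g : abscont a b f g -> measurable_fun `]a, b[ f.
Proof.
move=> fg; have [ab|ba] := leP a b; last first.
  by rewrite set_itv_ge -?leNgt ?bnd_simp ?ltW//; exact: measurable_fun_set0.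
apply: (@measurable_funS _ _ _ _ `[a, b]) => //; first exact: subset_itv_oo_cc.
apply: subspace_continuous_measurable_fun => //.
exact: abscont_within_continuous fg.
Qed.

Lemma abscont_integrable a b f g : abscont a b f g -> forall u,
  mu.-integrable `]a, b[ (EFin \o u) ->
  mu.-integrable `]a, b[ (EFin \o (fun x => f x * u x)).
Proof.
move=> fg u ui.
rewrite (_ : _ \o _ = (EFin \o f) \* (EFin \o u))%E//.
apply: integrableMr => //; first exact: abscont_measurable fg.
have [M M0 Mf] := abscont_bounded fg.
exists M; split => [|r Mr x /=]; first by rewrite num_real.
rewrite in_itv/= => /andP[ax xb].
by rewrite (le_trans (Mf _ _)) ?ltW// !ltW.
Qed.

Lemma abscont_Rintegral a b f g : a <= b -> abscont a b f g ->
  \int[mu]_(x in `]a, b[) g x = f b - f a.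
Proof. by move=> ab [_ /(_ b)]; rewrite ab lexx => -> //; ring. Qed.

(** With F and G the primitives of [f'] and [g'] vanishing at [a], the product F(x) G(x) is the
    integral of [f'(s) g'(t)] over a square, and cutting the square along its diagonal gives the
    integrals of [f' G] and [g' F] up to x. The constants [f a] and [g a] account for the remaining
    terms. *)
Lemma abscont_mul a b f f' g g' : abscont a b f f' -> abscont a b g g' ->
  abscont a b (fun x => f x * g x) (fun x => f' x * g x + f x * g' x).
Proof.
move=> Hf Hg; have [fi fE] := Hf; have [gi gE] := Hg.
have i1 := abscont_integrable Hf gi; have i2 := abscont_integrable Hg fi.
have i2' : mu.-integrable `]a, b[ (EFin \o (fun x => f' x * g x)).
  by apply: eq_integrable i2 => // x _ /=; rewrite mulrC.
split.
  exact: (integrableD _ i2' i1).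
move=> x /[dup] axb /andP[ax xb].
pose D := `]a, x[%classic.
have mD : measurable D by exact: measurable_itv.
have sub h : mu.-integrable `]a, b[ (EFin \o h) -> mu.-integrable D (EFin \o h).
  exact: integrable_itv_oo_sub.
have rstr (h : R -> R) : mu.-integrable `]a, b[ (EFin \o h) ->
    mu.-integrable setT (EFin \o (h \_ D)).
  move=> /sub hi; rewrite -restrict_EFin.
  by have [H _] := @integrable_mkcond _ _ _ mu D (EFin \o h) mD; exact: H.
(* The truncation to [D] is invisible in the inner integral, because s < t < x there. *)
have key (h : R -> R) (t : R) : t \in D ->
    \int[mu]_s ((h \_ D) s * ltind (t, s)) = \int[mu]_(s in `]a, t[) h s.
  rewrite inE /D/= in_itv/= => /andP[at_ tx]; rewrite [RHS]Rintegral_mkcond.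
  apply: eq_Rintegral => s _; rewrite !patchE /ltind/=.
  rewrite /D !mem_setE !in_itv/=.
  have [st|st] := ltP s t; last by rewrite andbF mulr0.
  by rewrite (lt_trans st tx) mulr1.
have uv (h k : R -> R) : mu.-integrable `]a, b[ (EFin \o h) ->
    mu.-integrable `]a, b[ (EFin \o k) ->
    mu.-integrable D (EFin \o (fun t => h t * \int[mu]_(s in `]a, t[) k s)) /\
    \int[mu]_t ((h \_ D) t * \int[mu]_s ((k \_ D) s * ltind (t, s))) =
    \int[mu]_(t in D) (h t * \int[mu]_(s in `]a, t[) k s).
  move=> hi ki.
  have E : (fun t => (h \_ D) t * \int[mu]_s ((k \_ D) s * ltind (t, s))) =
     (fun t => h t * \int[mu]_(s in `]a, t[) k s) \_ D.
    apply/funext => t; rewrite [RHS]patchE [in LHS]patchE.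
    by case: ifPn => tD; rewrite ?mul0r// key.
  split; last by rewrite [RHS]Rintegral_mkcond; apply: eq_Rintegral => t _;
    rewrite -(congr1 (@^~ t) E).
  have [+ _] := Rintegral_triangle (rstr _ hi) (rstr _ ki).
  rewrite [X in mu.-integrable _ X](_ : _ = EFin \o
    ((fun t => h t * \int[mu]_(s in `]a, t[) k s) \_ D)); last first.
    by apply/funext => t /=; congr EFin; exact: (congr1 (@^~ t) E).
  rewrite -restrict_EFin.
  by have [_ H] := @integrable_mkcond _ _ _ mu D
    (EFin \o (fun t => h t * \int[mu]_(s in `]a, t[) k s)) mD; exact: H.
have [I1 E1] := uv _ _ fi gi; have [I2 E2] := uv _ _ gi fi.
have [_] := Rintegral_triangle (rstr _ fi) (rstr _ gi).
rewrite E1 E2 -!Rintegral_mkcond => T.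
rewrite (fE x axb) (gE x axb).
transitivity (f a * g a + (\int[mu]_(t in D) (f' t * g a) +
   \int[mu]_(t in D) (g' t * f a) +
   (\int[mu]_(t in D) (f' t * \int[mu]_(s in `]a, t[) g' s) +
    \int[mu]_(t in D) (g' t * \int[mu]_(s in `]a, t[) f' s)))).
  rewrite T !RintegralZr.
  - by rewrite -/D; ring.
  - exact: mD.
  - exact: sub gi.
  - exact: mD.
  - exact: sub fi.
have Zr h c : mu.-integrable D (EFin \o h) ->
    mu.-integrable D (EFin \o (fun t => h t * c)).
  by move=> hi; exact: (integrableZr _ c hi).
congr (_ + _).
have fi' := sub _ fi; have gi' := sub _ gi.
have addi h k : mu.-integrable D (EFin \o h) -> mu.-integrable D (EFin \o k) ->
    mu.-integrable D (EFin \o (fun t => h t + k t)).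
  by move=> hi ki; exact: (integrableD _ hi ki).
rewrite -RintegralD; [|exact: mD|exact: Zr|exact: Zr].
rewrite -[X in _ + X]RintegralD; [|exact: mD|exact: I1|exact: I2].
rewrite -RintegralD; [|exact: mD|by apply: addi; exact: Zr|exact: addi].
apply: eq_Rintegral => t; rewrite inE /D/= in_itv/= => /andP[at_ tx].
have atb : a <= t <= b by rewrite (ltW at_) (le_trans (ltW tx)).
rewrite (fE t atb) (gE t atb); ring.
Qed.

Lemma abscont_add a b f f' g g' : abscont a b f f' -> abscont a b g g' ->
  abscont a b (fun x => f x + g x) (fun x => f' x + g' x).
Proof.
move=> [fi fE] [gi gE]; split; first exact: (integrableD _ fi gi).
move=> x /[dup] axb /andP[ax xb]; rewrite (fE x)// (gE x)// RintegralD//.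
- ring.
- exact: integrable_itv_oo_sub fi.
- exact: integrable_itv_oo_sub gi.
Qed.

Lemma abscont_scale a b c f f' : abscont a b f f' ->
  abscont a b (fun x => c * f x) (fun x => c * f' x).
Proof.
move=> [fi fE]; split; first exact: (integrableZl _ c fi).
move=> x /[dup] axb /andP[ax xb]; rewrite (fE x)// RintegralZl//.
- ring.
- exact: integrable_itv_oo_sub fi.
Qed.

Lemma is_derive_cvg (f : R -> R) (x df : R) :
  is_derive x (1 : R) f df -> f y @[y --> x] --> f x.
Proof.
by move=> d; apply: differentiable_continuous; apply/derivable1_diffP.
Qed.

(** Brings smooth multipliers (constants, the identity, a tangent) into the product rule, by the
    fundamental theorem of calculus on each [[a, x]]. *)
Lemma abscont_C1 a b f f' : (forall x, a <= x <= b -> is_derive x 1 f (f' x)) ->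
  {within `[a, b], continuous f'} -> abscont a b f f'.
Proof.
move=> df cf'; split.
  apply/itv_oo_cc_integrable; apply: continuous_compact_integrable => //.
  exact: segment_compact.
move=> x /andP[]; rewrite le_eqVlt => /predU1P[<- _|ax xb].
  by rewrite set_itv_ge ?bnd_simp ?ltxx// Rintegral_set0 addr0.
have axb : {subset `[a, x] <= `[a, b]}.
  by move=> y; rewrite !in_itv/= => /andP[-> /= /le_trans ->].
have fcont y : a <= y <= b -> f z @[z --> y] --> f y.
  by move=> /df; exact: is_derive_cvg.
have E : (\int[mu]_(y in `[a, x]) (f' y)%:E = (f x)%:E - (f a)%:E)%E.
  apply: continuous_FTC2 => //.
  - apply: continuous_subspaceW cf' => y /=; exact: axb.
  - split.
    + move=> y; rewrite in_itv/= => /andP[ay yx].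
      by have := df y; rewrite (ltW ay) (le_trans (ltW yx) xb) => /(_ isT)[].
    + by apply/cvg_at_right_filter/fcont; rewrite lexx (le_trans (ltW ax)).
    + by apply/cvg_at_left_filter/fcont; rewrite xb ltW.
  - move=> y; rewrite in_itv/= => /andP[ay yx]; rewrite derive1E.
    have := df y; rewrite (ltW ay) (le_trans (ltW yx) xb) => /(_ isT) d.
    exact: derive_val.
rewrite /Rintegral -(@integral_itv_bndoo _ a x _ true false) ?E//=.
  by ring.
apply/measurable_EFinP; apply: (@measurable_funS _ _ _ _ `[a, x]) => //;
  first exact: subset_itv_oo_cc.
apply: subspace_continuous_measurable_fun => //.
apply: continuous_subspaceW cf' => y /=; exact: axb.
Qed.

End ac.

(** * Weighted L^2 products along differentiable curves *)

Section l2.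
Context {R : realType}.
Notation mu := (@lebesgue_measure R).
Implicit Types (a b c s x C : R) (f g w : R -> R).

Lemma integrable_add a b f g : mu.-integrable `]a, b[ (EFin \o f) ->
  mu.-integrable `]a, b[ (EFin \o g) ->
  mu.-integrable `]a, b[ (EFin \o (fun x => f x + g x)).
Proof. by move=> fi gi; exact: (integrableD _ fi gi). Qed.

Lemma integrable_scale a b c f : mu.-integrable `]a, b[ (EFin \o f) ->
  mu.-integrable `]a, b[ (EFin \o (fun x => c * f x)).
Proof. by move=> fi; exact: (integrableZl _ c fi). Qed.

Lemma integrable_ext a b f g : f =1 g -> mu.-integrable `]a, b[ (EFin \o f) ->
  mu.-integrable `]a, b[ (EFin \o g).
Proof. by move=> /funext ->. Qed.

Definition L2 a b f : Prop :=
  measurable_fun `]a, b[ f /\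
  mu.-integrable `]a, b[ (EFin \o (fun x => f x ^+ 2)).

Lemma Lp2_L2 a b f : Lp 2%:E a b f -> L2 a b f.
Proof.
move=> /[dup] /Lfun2_integrable_sqr fi; rewrite /Lp inE => /andP[+ _].
rewrite inE/= => mf; split; first exact/(measurable_restrictT _ _).2.
have [_ H] := @integrable_mkcond _ _ _ mu `]a, b[
  (EFin \o (fun x => f x ^+ 2)) (measurable_itv _); apply: H.
apply: eq_integrable fi => // x _ /=; rewrite !patchE.
by case: ifPn => // _; rewrite expr0n.
Qed.

Lemma L2_bounded_mul a b w f C : measurable_fun `]a, b[ w ->
  (forall x, a < x < b -> `|w x| <= C) -> L2 a b f ->
  L2 a b (fun x => w x * f x).
Proof.
move=> mw wC [mf fi]; split; first exact: measurable_funM.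
apply: (@le_integrable _ _ _ mu _ _ _ (EFin \o (fun x => C ^+ 2 * f x ^+ 2))) => //.
- by apply/measurable_EFinP/measurable_funX/measurable_funM.
- move=> x; rewrite /= in_itv/= => axb; rewrite lee_fin exprMn !normrM.
  by rewrite ler_wpM2r ?mulr_ge0// ler_pM// (le_trans (wC x axb))// ler_norm.
- exact: integrable_scale.
Qed.

Lemma L2_mul a b f g : L2 a b f -> L2 a b g ->
  mu.-integrable `]a, b[ (EFin \o (fun x => f x * g x)).
Proof.
move=> [mf fi] [mg gi].
apply: (@le_integrable _ _ _ mu _ _ _
  (EFin \o (fun x => f x ^+ 2 + g x ^+ 2))) => //.
- exact/measurable_EFinP/measurable_funM.
- move=> x _ /=; rewrite lee_fin normrM [leRHS]ger0_norm ?addr_ge0 ?sqr_ge0//.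
  rewrite -(real_normK (num_real (f x))) -(real_normK (num_real (g x))).
  have := sqr_ge0 (`|f x| - `|g x|); have := normr_ge0 (f x); have := normr_ge0 (g x).
  nra.
- exact: integrable_add.
Qed.

Lemma L2_add a b f g : L2 a b f -> L2 a b g -> L2 a b (fun x => f x + g x).
Proof.
move=> Hf Hg; have fg := L2_mul Hf Hg.
have [mf fi] := Hf; have [mg gi] := Hg; split; first exact: measurable_funD.
have := integrable_add (integrable_add fi gi) (integrable_scale 2 fg).
by apply: integrable_ext => x; ring.
Qed.

Lemma L2_scale a b c f : L2 a b f -> L2 a b (fun x => c * f x).
Proof.
by move=> Hf; apply: (@L2_bounded_mul _ _ (cst c) _ `|c|) => //; exact: measurable_cst.
Qed.

Lemma L2_lin a b c f g : L2 a b f -> L2 a b g -> L2 a b (fun x => c * f x + g x).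
Proof. by move=> Hf Hg; apply: L2_add => //; exact: L2_scale. Qed.

Lemma L2_sub a b f g : L2 a b f -> L2 a b g -> L2 a b (fun x => f x - g x).
Proof.
move=> Hf Hg; rewrite (_ : (fun x => _) = (fun x => f x + (-1) * g x)).
  by apply: L2_add => //; exact: L2_scale.
by apply/funext => x; rewrite mulN1r.
Qed.

Lemma L2_oppB a b f g : L2 a b f -> L2 a b g -> L2 a b (fun x => - f x - g x).
Proof.
move=> Hf Hg; rewrite (_ : (fun x => _) = (fun x => -1 * f x - g x)).
  by apply: L2_sub => //; exact: L2_scale.
by apply/funext => x; rewrite mulN1r.
Qed.

Lemma L2_cst a b c : L2 a b (fun=> c).
Proof.
split; first exact: measurable_cst.
apply: measurable_bounded_integrable => //.
- rewrite [X in (X < _)%E](_ : _ = lebesgue_measure `]a, b[%classic)//.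
  by rewrite lebesgue_measure_itv/=; case: ifPn; rewrite ?ltry// -EFinB ltry.
- exists (c ^+ 2); split => [|r cr x _ /=]; rewrite ?num_real//.
  by rewrite ger0_norm ?sqr_ge0// ltW.
Qed.

Lemma L2_integrable a b f : L2 a b f -> mu.-integrable `]a, b[ (EFin \o f).
Proof.
move=> fi; have := L2_mul fi (L2_cst a b 1).
by apply: integrable_ext => x; rewrite mulr1.
Qed.

Lemma abscont_L2 a b f g : abscont a b f g -> L2 a b f.
Proof.
move=> fg; have [M M0 fM] := abscont_bounded fg.
have := @L2_bounded_mul a b f (fun=> 1) M (abscont_measurable fg) _ (L2_cst a b 1).
rewrite (_ : (fun x => _) = f); last by apply/funext => x; rewrite mulr1.
by apply => x /andP[ax xb]; rewrite fM// !ltW.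
Qed.

Lemma sobolev_derivative_abscont a b f g :
  sobolev_derivative 2%:E a b f g -> abscont a b f g.
Proof. by move=> [gi fE]; split => //; exact/L2_integrable/Lp2_L2. Qed.

(** A real-valued integral is 0 by convention when the extended one is infinite. A small value of
    such an integral is thus informative only for functions known to be in L^2, which is why the
    statements on limits carry [L2] hypotheses. *)
Definition ip a b w f g := \int[mu]_(x in `]a, b[) (w x * (f x * g x)).

Definition nrm a b f := ip a b (fun=> 1) f f.

Definition weight a b w C := measurable_fun `]a, b[ w /\
  forall x, a < x < b -> `|w x| <= C.

Lemma ip_integrable a b w C f g : weight a b w C -> L2 a b f -> L2 a b g ->
  mu.-integrable `]a, b[ (EFin \o (fun x => w x * (f x * g x))).
Proof.
move=> [mw wC] Hf Hg; have := L2_mul (L2_bounded_mul mw wC Hf) Hg.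
by apply: integrable_ext => x; rewrite mulrA.
Qed.

Lemma weight1 a b : weight a b (fun=> 1) 1.
Proof. by split => [|x _]; [exact: measurable_cst|rewrite normr1]. Qed.

Lemma ipC a b w f g : ip a b w f g = ip a b w g f.
Proof. by apply: eq_Rintegral => x _; rewrite (mulrC (f x)). Qed.

Lemma ip_linl a b w C c f g h : weight a b w C ->
  L2 a b f -> L2 a b g -> L2 a b h ->
  ip a b w (fun x => c * f x + g x) h = c * ip a b w f h + ip a b w g h.
Proof.
move=> wC Hf Hg Hh; have ifh := ip_integrable wC Hf Hh.
have igh := ip_integrable wC Hg Hh.
rewrite /ip -RintegralZl// -RintegralD//; last exact: integrable_scale.
by apply: eq_Rintegral => x _; ring.
Qed.

Lemma ip_expand a b w C c f1 f2 g1 g2 : weight a b w C ->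
  L2 a b f1 -> L2 a b f2 -> L2 a b g1 -> L2 a b g2 ->
  ip a b w (fun x => c * f1 x + f2 x) (fun x => c * g1 x + g2 x) =
  c ^+ 2 * ip a b w f1 g1 + c * (ip a b w f1 g2 + ip a b w f2 g1) + ip a b w f2 g2.
Proof.
move=> wC Hf1 Hf2 Hg1 Hg2; rewrite (ip_linl c wC)//; last exact: L2_lin.
rewrite ![ip a b w _ (fun x => c * g1 x + g2 x)]ipC !(ip_linl c wC)//.
rewrite ![ip a b w _ f1]ipC ![ip a b w _ f2]ipC; ring.
Qed.

Lemma nrm_ge0 a b f : 0 <= nrm a b f.
Proof. by apply: Rintegral_ge0 => x _; rewrite mul1r -expr2 sqr_ge0. Qed.

(** Pointwise this is [(s |f| - |g|)^2 >= 0] divided by [s]. The free parameter replaces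
    Cauchy-Schwarz: [s = 1] bounds the cross term of V, and a small [s] absorbs a fixed factor in
    limits. *)
Lemma ip_young a b w C s f g : weight a b w C -> 0 < s -> 0 <= C ->
  L2 a b f -> L2 a b g ->
  `|ip a b w f g| <= C / 2 * (s * nrm a b f + s^-1 * nrm a b g).
Proof.
move=> wC s0 C0 Hf Hg; have ifg := ip_integrable wC Hf Hg.
have iff := ip_integrable (weight1 a b) Hf Hf.
have igg := ip_integrable (weight1 a b) Hg Hg.
have iff' := integrable_scale s iff.
have igg' := integrable_scale s^-1 igg.
rewrite (le_trans (le_normr_Rintegral _ ifg))//.
rewrite /nrm /ip -!RintegralZl// -RintegralD//.
rewrite -RintegralZl//; last exact: integrable_add.
apply: le_Rintegral => //.
- exact: (integrable_norm ifg).
- by apply: integrable_scale; exact: integrable_add.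
move=> x; rewrite /= in_itv/= => axb; rewrite normrM.
rewrite -mulrA ler_pM//; first exact: wC.2.
rewrite !mul1r -!expr2 normrM.
have := sqr_ge0 (s * `|f x| - `|g x|).
rewrite -(real_normK (num_real (f x))) -(real_normK (num_real (g x))).
have := normr_ge0 (f x); have := normr_ge0 (g x).
move: (`|f x|) (`|g x|) => u v v0 u0 h.
rewrite -(ler_pM2l s0).
rewrite [X in _ <= X](_ : _ = 2^-1 * ((s * u) ^+ 2 + v ^+ 2)); last first.
  by field; rewrite gt_eqF.
nra.
Qed.

Lemma ip_bound a b w C s f g : weight a b w C -> 0 < s -> 0 <= C ->
  L2 a b f -> L2 a b g ->
  `|ip a b w f g| <= C * (s * nrm a b f + s^-1 * nrm a b g).
Proof.
move=> wC s0 C0 Hf Hg; rewrite (le_trans (ip_young wC s0 C0 Hf Hg))//.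
rewrite ler_wpM2r ?addr_ge0 ?mulr_ge0 ?nrm_ge0 ?invr_ge0 ?(ltW s0)//.
by rewrite ler_pdivrMr// ler_peMr// ler1n.
Qed.

Lemma ip_cvg {T : Type} (F : set_system T) {FF : Filter F} a b w C
    (r q : T -> R -> R) f g : weight a b w C ->
  (\forall i \near F, L2 a b (r i)) -> (\forall i \near F, L2 a b (q i)) ->
  L2 a b f -> L2 a b g ->
  nrm a b (fun x => r i x - f x) @[i --> F] --> (0 : R) ->
  nrm a b (fun x => q i x - g x) @[i --> F] --> (0 : R) ->
  ip a b w (r i) (q i) @[i --> F] --> ip a b w f g.
Proof.
move=> wC Hr Hq Hf Hg rf qg; apply/cvgrPdist_le => /= e e0.
(* [C] may be 0, or even negative on an empty interval; [K] is a bound by which one can divide. *)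
have [K K1 wK] : exists2 K, 1 <= K & weight a b w K.
  exists (`|C| + 1); first by rewrite lerDr.
  case: wC => mw wC; split => // x /wC /le_trans; apply.
  by rewrite (le_trans (ler_norm _))// lerDl.
have K0 : 0 < K by rewrite (lt_le_trans ltr01).
pose N := 1 + nrm a b f + nrm a b g.
have N0 : 0 < N by rewrite /N -addrA ltr_pwDl// addr_ge0 ?nrm_ge0.
(* The error splits into the pairing of two small differences and two pairings of a small difference
   with a fixed function. The choice of [s] leaves e/4 in total for the norms of [f] and [g]; then
   [d], which depends on [s], leaves e/8 for each difference weighted by [s^-1] and e/4 for each one
   in the first pairing. The sum is e. *)
pose s := e / (4 * (K * N)).
have s0 : 0 < s by rewrite divr_gt0// !mulr_gt0.
have sN : K * (s * N) = e / 4 by rewrite /s; field; rewrite !gt_eqF.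
pose d := Num.min (e / (4 * K)) (s * (e / (8 * K))).
have d0 : 0 < d.
  have e4 : 0 < e / (4 * K) by rewrite divr_gt0 ?mulr_gt0.
  have e8 : 0 < e / (8 * K) by rewrite divr_gt0 ?mulr_gt0.
  by rewrite lt_min e4 mulr_gt0.
have d4 : K * d <= e / 4.
  rewrite (_ : e / 4 = K * (e / (4 * K))); last by field; rewrite gt_eqF.
  by rewrite ler_pM2l// ge_min lexx.
have d8 : K * (s^-1 * d) <= e / 8.
  rewrite (_ : e / 8 = K * (s^-1 * (s * (e / (8 * K))))); last first.
    by field; rewrite !gt_eqF.
  by rewrite !ler_pM2l ?invr_gt0// ge_min lexx orbT.
move/cvgrPdist_lt : rf => /(_ _ d0) rf; move/cvgrPdist_lt : qg => /(_ _ d0) qg.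
near=> i.
have Hri : L2 a b (r i) by near: i.
have Hqi : L2 a b (q i) by near: i.
have nr' : `|0 - nrm a b (fun x => r i x - f x)| < d by near: i.
have nq' : `|0 - nrm a b (fun x => q i x - g x)| < d by near: i.
pose r' x := r i x - f x; pose q' x := q i x - g x.
have Hr' : L2 a b r' by exact: L2_sub.
have Hq' : L2 a b q' by exact: L2_sub.
rewrite sub0r normrN ger0_norm ?nrm_ge0// -/r' in nr'.
rewrite sub0r normrN ger0_norm ?nrm_ge0// -/q' in nq'.
move/ltW in nr'; move/ltW in nq'.
have -> : r i = (fun x => 1 * r' x + f x) by apply/funext => x; rewrite /r'; ring.
have -> : q i = (fun x => 1 * q' x + g x) by apply/funext => x; rewrite /q'; ring.
rewrite (ip_expand _ wK)//.
have B1 := ip_bound wK ltr01 (ltW K0) Hr' Hq'.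
have B2 := ip_bound wK s0 (ltW K0) Hg Hr'.
have B3 := ip_bound wK s0 (ltW K0) Hf Hq'.
rewrite ipC in B2.
have S1 : K * (s^-1 * nrm a b r') <= e / 8.
  by rewrite (le_trans _ d8)// !ler_pM2l ?invr_gt0.
have S2 : K * (s^-1 * nrm a b q') <= e / 8.
  by rewrite (le_trans _ d8)// !ler_pM2l ?invr_gt0.
have T1 : K * nrm a b r' <= e / 4 by rewrite (le_trans _ d4)// ler_pM2l.
have T2 : K * nrm a b q' <= e / 4 by rewrite (le_trans _ d4)// ler_pM2l.
have T3 : K * (s * nrm a b f) + K * (s * nrm a b g) <= e / 4.
  by rewrite -sN -!mulrDr !ler_pM2l// /N -addrA lerDr.
rewrite (_ : _ - _ = - (ip a b w r' q' + ip a b w r' g + ip a b w f q')); last ring.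
rewrite normrN (le_trans (ler_normD _ _))//.
rewrite (le_trans (lerD (ler_normD _ _) (lexx _)))//.
rewrite (le_trans (lerD (lerD B1 B2) B3))//.
rewrite mul1r invr1 mul1r !mulrDr.
set A1 := K * nrm a b r' in T1 *; set A2 := K * nrm a b q' in T2 *.
move: S1 S2 T3 => S1 S2 T3.
lra.
Unshelve. all: by end_near. Qed.

Lemma dnbhs0_shift (P : R -> Prop) (t : R) : (\forall s \near t, P s) ->
  \forall h \near (0 : R)^', P (t + h).
Proof.
have : (t + h) @[h --> (0 : R)^'] --> t.
  rewrite -[X in _ --> X]addr0; apply: cvgD; first exact: cvg_cst.
  exact: nbhs_dnbhs.
by apply.
Qed.

(** With [q] the difference quotients, the quotient of the form is exactly [ip (q f) (g t) + ip (f
    t) (q g) + h ip (q f) (q g)], and each term converges by continuity of the form in L^2. No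
    differentiation under the integral sign takes place. *)
Lemma ip_is_derive a b w C (f g : R -> R -> R) (t : R) (f' g' : R -> R) :
  weight a b w C -> (\forall s \near t, L2 a b (f s)) ->
  (\forall s \near t, L2 a b (g s)) -> L2 a b f' -> L2 a b g' ->
  nrm a b (fun x => h^-1 * (f (t + h) x - f t x) - f' x) @[h --> 0^'] --> (0 : R) ->
  nrm a b (fun x => h^-1 * (g (t + h) x - g t x) - g' x) @[h --> 0^'] --> (0 : R) ->
  is_derive t (1 : R) (fun s => ip a b w (f s) (g s))
    (ip a b w f' (g t) + ip a b w (f t) g').
Proof.
move=> wC Hf Hg Hf' Hg' df dg.
have Hft : L2 a b (f t) by exact: nbhs_singleton Hf.
have Hgt : L2 a b (g t) by exact: nbhs_singleton Hg.
have h0 : h @[h --> (0 : R)^'] --> (0 : R) by exact: nbhs_dnbhs.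
pose q (u : R -> R -> R) h := fun x => h^-1 * (u (t + h) x - u t x).
have Lq (u : R -> R -> R) : (\forall s \near t, L2 a b (u s)) ->
    \forall h \near (0 : R)^', L2 a b (q u h).
  move=> Hu; have Hut : L2 a b (u t) by exact: nbhs_singleton Hu.
  move/dnbhs0_shift : Hu; apply: filterS => h Hh.
  by apply: L2_scale; exact: L2_sub.
have c0 (u : R -> R) : L2 a b u ->
    nrm a b (fun x => u x - u x) @[h --> (0 : R)^'] --> (0 : R).
  move=> Hu; rewrite (_ : (fun _ => _) = cst 0); first exact: cvg_cst.
  apply/funext => h; rewrite /nrm /ip /=.
  under eq_Rintegral do rewrite subrr mulr0 mulr0.
  by rewrite Rintegral_cst//= mul0r.
have FF : Filter (0 : R)^' by exact: filter_filter.
have C1 : ip a b w (q f h) (g t) @[h --> (0 : R)^'] --> ip a b w f' (g t).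
  by apply: (ip_cvg wC) => //; [exact: Lq|exact: nearW|exact: c0].
have C2 : ip a b w (f t) (q g h) @[h --> (0 : R)^'] --> ip a b w (f t) g'.
  by apply: (ip_cvg wC) => //; [exact: nearW|exact: Lq|exact: c0].
have C3 : ip a b w (q f h) (q g h) @[h --> (0 : R)^'] --> ip a b w f' g'.
  by apply: (ip_cvg wC) => //; exact: Lq.
have C4 : ip a b w (q f h) (g t) + ip a b w (f t) (q g h) +
    h * ip a b w (q f h) (q g h) @[h --> (0 : R)^'] -->
    ip a b w f' (g t) + ip a b w (f t) g'.
  rewrite -[X in _ --> X]addr0 -[X in _ --> _ + X](mul0r (ip a b w f' g')).
  by apply: cvgD; [exact: cvgD|exact: cvgM].
have lim : h^-1 *: ((ip a b w (f (t + h)) (g (t + h)) - ip a b w (f t) (g t)) : R^o)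
    @[h --> (0 : R)^'] --> ip a b w f' (g t) + ip a b w (f t) g'.
  have nf := dnbhs0_shift (P := fun s => L2 a b (f s)) Hf.
  have ng := dnbhs0_shift (P := fun s => L2 a b (g s)) Hg.
  have nqf := Lq _ Hf; have nqg := Lq _ Hg.
  apply: cvg_trans C4; apply: near_eq_cvg; near=> h.
  have hn0 : h != 0 by near: h; exact: nbhs_dnbhs_neq.
  have Lfh : L2 a b (f (t + h)) by near: h.
  have Lgh : L2 a b (g (t + h)) by near: h.
  have Lqf : L2 a b (q f h) by near: h.
  have Lqg : L2 a b (q g h) by near: h.
  have E (u : R -> R -> R) : u (t + h) = fun x => h * q u h x + u t x.
    by apply/funext => x; rewrite /q mulrA mulfV// mul1r subrK.
  rewrite [in RHS](E f) [in RHS](E g) (ip_expand _ wC)// -/(q f h) -/(q g h).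
  rewrite addrK /GRing.scale/= [X in X = _]/=.
  by field.
have lim' : h^-1 *: (((fun s => ip a b w (f s) (g s) : R^o) \o shift t)
    (h *: (1 : R^o)) - ip a b w (f t) (g t)) @[h --> (0 : R)^'] -->
    ip a b w f' (g t) + ip a b w (f t) g'.
  rewrite (_ : (fun h => _) =
    (fun h => h^-1 *:
      ((ip a b w (f (t + h)) (g (t + h)) - ip a b w (f t) (g t)) : R^o)));
    first exact: lim.
  by apply/funext => h; rewrite /= [h *: _]mulr1 (addrC h t).
apply: DeriveDef; first by apply/cvg_ex; eexists; exact: lim'.
exact: cvg_lim lim'.
Unshelve. all: by end_near. Qed.

End l2.

(** * Wirtinger inequality and multiplier identities *)

Section identities.
Context {R : realType}.
Notation mu := (@lebesgue_measure R).
Implicit Types (a b c x L k m : R) (f g w : R -> R).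

Lemma abscont_cst a b c : abscont a b (fun=> c) (fun=> 0).
Proof.
by apply: abscont_C1 => x; exact: cvg_cst.
Qed.

Lemma abscont_id a b : abscont a b id (fun=> 1).
Proof.
by apply: abscont_C1 => x; exact: cvg_cst.
Qed.

Lemma weight_id L : weight 0 L id L.
Proof.
split => [|x /andP[x0 xL]]; first exact: measurable_id.
by rewrite ger0_norm ltW.
Qed.

Lemma nrmE a b f : nrm a b f = \int[mu]_(x in `]a, b[) (f x ^+ 2).
Proof. by apply: eq_Rintegral => x _; rewrite mul1r. Qed.

(* The multiplier tan(k(x - L/2)) is smooth on [0, L] for k < pi/L, and
   g^2 - k^2 f^2 = (g + k tan f)^2 - k (tan f^2)'. *)
Lemma wirtinger_lt L k f g : 0 < L -> 0 < k -> k < pi / L ->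
  abscont 0 L f g -> L2 0 L g -> f 0 = 0 -> f L = 0 ->
  k ^+ 2 * nrm 0 L f <= nrm 0 L g.
Proof.
move=> L0 k0 kL fg Hg f0 fL.
pose A x := k * (x - L / 2); pose T x := tan (A x).
have dA x : is_derive x (1 : R) A k.
  have : is_derive x (1 : R) A (k *: (1 - 0)).
    by apply: is_deriveZ; apply: is_deriveB.
  by rewrite subr0 [k *: 1]mulr1.
have cosA x : 0 <= x <= L -> cos (A x) != 0.
  move=> /andP[x0 xL]; rewrite gt_eqF// cos_gt0_pihalf//.
  have kL2 : k * L < pi by rewrite -ltr_pdivlMr.
  by rewrite /A; apply/andP; split; nra.
have dT x : 0 <= x <= L -> is_derive x (1 : R) T (k * (1 + T x ^+ 2)).
  move=> x0L; have dt := is_derive_tan (cosA _ x0L).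
  have := is_derive1_comp dt (dA x).
  by rewrite cos2_tan2 ?cosA// mulrC.
have aT : abscont 0 L T (fun x => k * (1 + T x ^+ 2)).
  apply: abscont_C1 => //.
  apply: derivable_within_continuous => x; rewrite in_itv/= => x0L.
  have d := dT _ x0L.
  by apply: derivableM => //; apply: derivableD.
have aTff := abscont_mul aT (abscont_mul fg fg).
have iTff := (abscont_scale (- k) aTff).1.
have L2f := abscont_L2 fg.
have E : \int[mu]_(x in `]0, L[)
   (- k * (k * (1 + T x ^+ 2) * (f x * f x) + T x * (g x * f x + f x * g x))) = 0.
  have := abscont_Rintegral (ltW L0) (abscont_scale (- k) aTff).
  by rewrite /= f0 fL !(mulr0, mul0r) subrr => ->.
rewrite -subr_ge0 -[X in X <= _]E.
have iff0 := ip_integrable (weight1 0 L) L2f L2f.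
have iff := integrable_scale (- k ^+ 2) iff0.
have igg := ip_integrable (weight1 0 L) Hg Hg.
rewrite (_ : nrm 0 L g - _ = \int[mu]_(x in `]0, L[)
   (1 * (g x * g x) + - k ^+ 2 * (1 * (f x * f x)))); last first.
  by rewrite /nrm /ip -mulNr -RintegralZl// -RintegralD.
apply: le_Rintegral => //; first exact: integrable_add.
move=> x _ /=; rewrite -subr_ge0.
rewrite (_ : _ - _ = (g x + k * T x * f x) ^+ 2); last ring.
by rewrite sqr_ge0.
Qed.

(** At the sharp constant the tangent multiplier blows up at both endpoints, so the inequality is
    reached by letting k increase to [pi / L]. *)
Lemma wirtinger L f g : 0 < L -> abscont 0 L f g -> L2 0 L g -> f 0 = 0 -> f L = 0 ->
  (pi / L) ^+ 2 * nrm 0 L f <= nrm 0 L g.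
Proof.
move=> L0 fg Hg f0 fL; have pL : 0 < pi / L by rewrite divr_gt0 ?pi_gt0.
have lim : (k ^+ 2 * nrm 0 L f) @[k --> (pi / L)^'-] --> (pi / L) ^+ 2 * nrm 0 L f.
  apply: cvgM; last exact: cvg_cst.
  by rewrite expr2; apply: cvgM; apply: cvg_at_left_filter; exact: cvg_id.
rewrite -(cvg_lim _ lim)//; apply: limr_le; first by apply/cvg_ex; eexists; exact: lim.
by near=> k; apply: wirtinger_lt.
Unshelve. all: by end_near. Qed.

(** Reduces an integral identity to a pointwise one, between the given integrand and the derivative
    assembled by the product rule, which [ring] or [field] decides. *)
Lemma abscont_Rintegral_eq a b f g h : a <= b -> abscont a b f g ->
  (forall x, h x = g x) -> \int[mu]_(x in `]a, b[) h x = f b - f a.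
Proof. by move=> ab /(abscont_Rintegral ab) <- hg; apply: eq_Rintegral => x _. Qed.

(* f g3 + g f3 = (f g2 + g f2 - f1 g1)' *)
Lemma energy_flux L (f f1 f2 f3 g g1 g2 g3 : R -> R) : 0 < L ->
  abscont 0 L f f1 -> abscont 0 L f1 f2 -> abscont 0 L f2 f3 -> L2 0 L f3 ->
  abscont 0 L g g1 -> abscont 0 L g1 g2 -> abscont 0 L g2 g3 -> L2 0 L g3 ->
  f 0 = 0 -> f L = 0 -> g 0 = 0 -> g L = 0 -> f1 0 = 0 ->
  ip 0 L (fun=> 1) f (fun x => - g1 x - g3 x) +
  ip 0 L (fun=> 1) g (fun x => - f1 x - f3 x) = f1 L * g1 L.
Proof.
move=> L0 Hf Hf1 Hf2 Lf3 Hg Hg1 Hg2 Lg3 f0 fL g0 gL f10.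
have I1 := ip_integrable (weight1 0 L) (abscont_L2 Hf) (L2_oppB (abscont_L2 Hg1) Lg3).
have I2 := ip_integrable (weight1 0 L) (abscont_L2 Hg) (L2_oppB (abscont_L2 Hf1) Lf3).
rewrite /ip -RintegralD//.
have HG := abscont_add (abscont_scale (-1) (abscont_mul Hf Hg)) (abscont_add
  (abscont_scale (-1) (abscont_mul Hf Hg2)) (abscont_add
  (abscont_scale (-1) (abscont_mul Hg Hf2)) (abscont_mul Hf1 Hg1))).
rewrite (abscont_Rintegral_eq (ltW L0) HG) => [|x]; last by ring.
by rewrite f0 fL g0 gL f10; ring.
Qed.

(* x f f3 = (x f f2 - x f1^2 / 2 - f f1)' + 3/2 f1^2 *)
Lemma multiplier_identity L (f f1 f2 f3 : R -> R) : 0 < L ->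
  abscont 0 L f f1 -> abscont 0 L f1 f2 -> abscont 0 L f2 f3 -> L2 0 L f3 ->
  f 0 = 0 -> f L = 0 ->
  ip 0 L id f (fun x => - f1 x - f3 x) =
  L / 2 * f1 L ^+ 2 + 2^-1 * nrm 0 L f - 3 / 2 * nrm 0 L f1.
Proof.
move=> L0 Hf Hf1 Hf2 Lf3 f0 fL.
have Lv := L2_oppB (abscont_L2 Hf1) Lf3.
have I1 := ip_integrable (weight_id L) (abscont_L2 Hf) Lv.
have I2 := integrable_scale (- 2^-1)
  (ip_integrable (weight1 0 L) (abscont_L2 Hf) (abscont_L2 Hf)).
have I3 := integrable_scale (3 / 2)
  (ip_integrable (weight1 0 L) (abscont_L2 Hf1) (abscont_L2 Hf1)).
have HX := abscont_id 0 L.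
have HG := abscont_add
  (abscont_scale (- 2^-1) (abscont_mul HX (abscont_mul Hf Hf))) (abscont_add
  (abscont_scale (-1) (abscont_mul HX (abscont_mul Hf Hf2))) (abscont_add
  (abscont_scale 2^-1 (abscont_mul HX (abscont_mul Hf1 Hf1))) (abscont_mul Hf Hf1))).
have E : ip 0 L id f (fun x => - f1 x - f3 x) - 2^-1 * nrm 0 L f
    + 3 / 2 * nrm 0 L f1 = L / 2 * f1 L ^+ 2.
  rewrite /nrm /ip -mulNr -RintegralZl//; last first.
    exact: (ip_integrable (weight1 0 L) (abscont_L2 Hf) (abscont_L2 Hf)).
  rewrite -[X in _ + _ + X]RintegralZl//; last first.
    exact: (ip_integrable (weight1 0 L) (abscont_L2 Hf1) (abscont_L2 Hf1)).
  rewrite -RintegralD// -RintegralD//; last exact: integrable_add.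
  rewrite (abscont_Rintegral_eq (ltW L0) HG) => [|x]; last by field.
  by rewrite f0 fL; field.
by rewrite -E; ring.
Qed.

(** The weight decreases from [1 + m] at the fresh trace (rho = 0) to 1 at the delayed one (rho =
    1); its slope [- m] is the source of the interior damping of [z]. *)
Definition delay_weight m x := 1 + m * (1 - x).

Lemma weight_delay m : 0 <= m -> weight 0 1 (delay_weight m) (1 + m).
Proof.
move=> m0; split => [|x /andP[x0 x1]].
  apply: measurable_funD => //; apply: measurable_funM => //.
  exact: measurable_funB.
by rewrite /delay_weight ger0_norm; nra.
Qed.

Lemma weight_transport (dth : R) : weight 0 1 (fun x => dth * x - 1) (`|dth| + 1).
Proof.
split => [|x /andP[x0 x1]].
  by apply: measurable_funB => //; exact: measurable_funM.
rewrite (le_trans (ler_normB _ _))// normr1 lerD2r normrM ler_piMr//.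
by rewrite ger0_norm ltW.
Qed.

Lemma L2_transport (dth th : R) (z1 : R -> R) : L2 0 1 z1 ->
  L2 0 1 (fun x => (dth * x - 1) / th * z1 x).
Proof.
move=> Lz1; have [mw wC] := weight_transport dth.
rewrite (_ : (fun x => _) = (fun x => th^-1 * ((dth * x - 1) * z1 x))).
  by apply: L2_scale; exact: L2_bounded_mul mw wC Lz1.
by apply/funext => x; ring.
Qed.

(** The factor [th] cancels the denominator of the transport speed, and the term in [dth], due to
    the time derivative of the delay, completes the integrand to the derivative of [delay_weight m x
    * (dth * x - 1) * z x ^+ 2]. Only boundary values and the contribution of the slope [- m] are
    left. *)
Lemma delay_flux (m th dth : R) (z z1 : R -> R) : 0 <= m -> th != 0 ->
  abscont 0 1 z z1 -> L2 0 1 z1 ->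
  th * (2 * ip 0 1 (delay_weight m) z (fun x => (dth * x - 1) / th * z1 x)) +
    dth * ip 0 1 (delay_weight m) z z =
  (dth - 1) * z 1 ^+ 2 + (1 + m) * z 0 ^+ 2 +
  m * ip 0 1 (fun x => dth * x - 1) z z.
Proof.
move=> m0 th0 Hz Lz1.
have Hl : abscont 0 1 (fun x => dth * x + (-1)) (fun x => dth * 1 + 0).
  exact: abscont_add (abscont_scale dth (abscont_id 0 1)) (abscont_cst 0 1 (-1)).
have Hw : abscont 0 1 (fun x => (1 + m) + (- m) * x) (fun x => 0 + (- m) * 1).
  exact: abscont_add (abscont_cst 0 1 (1 + m)) (abscont_scale (- m) (abscont_id 0 1)).
have wl := weight_transport dth.
have Lv := L2_transport dth th Lz1.
have Lz := abscont_L2 Hz.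
have J1 := ip_integrable (weight_delay m0) Lz Lv.
have J2 := ip_integrable (weight_delay m0) Lz Lz.
have J3 := ip_integrable wl Lz Lz.
have I1 := integrable_scale (th * 2) J1.
have I2 := integrable_scale dth J2.
have I3 := integrable_scale (- m) J3.
have HG := abscont_mul (abscont_mul Hw Hl) (abscont_mul Hz Hz).
have E : th * (2 * ip 0 1 (delay_weight m) z (fun x => (dth * x - 1) / th * z1 x)) +
    dth * ip 0 1 (delay_weight m) z z - m * ip 0 1 (fun x => dth * x - 1) z z =
    (dth - 1) * z 1 ^+ 2 + (1 + m) * z 0 ^+ 2.
  rewrite /ip mulrA -mulNr -RintegralZl// -[X in _ + X + _]RintegralZl//.
  rewrite -[X in _ + _ + X]RintegralZl//.
  rewrite -RintegralD// -RintegralD//; last exact: integrable_add.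
  rewrite (abscont_Rintegral_eq (@ler01 R) HG) => [|x]; last first.
    by rewrite /delay_weight; field.
  by ring.
by rewrite -E; ring.
Qed.

End identities.

(** * The delay and Gronwall's lemma *)

Section delay.
Context {R : realType}.
Notation mu := (@lebesgue_measure R).
Implicit Types (a b t T : R) (f g tau dtau : R -> R).

Lemma Lpoo_integrable a b f : Lp +oo%E a b f ->
  mu.-integrable `]a, b[ (EFin \o f).
Proof.
rewrite /Lp inE => /andP[]; rewrite !inE/= => mf.
(* The norm of L^oo is the essential supremum only on a space of positive measure. *)
have muT : (0 < mu [set: R])%E.
  apply: (@lt_le_trans _ _ (mu `]0%R, 1%R[%classic)).
    by rewrite lebesgue_measure_itv/= lte_fin ltr01 sube0 lte_fin ltr01.
  by apply: le_measure; rewrite ?inE.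
rewrite /finite_norm unlock/= muT => fy.
have [M fM] : exists M : R, \forall x \ae mu, (`|(f \_ `]a, b[) x| <= M)%R.
  exact: (@ess_supr_bounded _ _ _ mu (fun x => `|(f \_ `]a, b[) x|)).
have mfab : measurable_fun `]a, b[ f by exact/(measurable_restrictT _ _).2.
apply/integrableP; split; first exact/measurable_EFinP.
have mab : (mu `]a, b[%classic < +oo)%E.
  by rewrite lebesgue_measure_itv/=; case: ifPn; rewrite ?ltry// -EFinB ltry.
apply: (@le_lt_trans _ _ ((`|M|)%:E * mu `]a, b[%classic)%E).
  apply: integral_le_bound => //; first exact/measurable_EFinP.
  case: fM => A [mA A0 sA]; exists A; split => // x /= /not_implyP[xab fx].
  apply: sA => /= fxM; apply: fx; move: fxM; rewrite patchE mem_set// lee_fin.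
  by move=> /le_trans; apply; exact: ler_norm.
by rewrite lte_mul_pinfty.
Qed.

Lemma sobolev_derivativeoo_abscont a b f g :
  sobolev_derivative +oo%E a b f g -> abscont a b f g.
Proof. by move=> [gi fE]; split => //; exact: Lpoo_integrable. Qed.

Lemma abscont_is_derive a b f g x : abscont a b f g -> {within `[a, b], continuous g} ->
  a < x < b -> is_derive x 1 f (g x).
Proof.
move=> [gi fE] cg axb; have /andP[ax xb] := axb; have ab := lt_trans ax xb.
have gi' : mu.-integrable `[a, b] (EFin \o g) by exact/itv_oo_cc_integrable.
have cgx : {for x, continuous g}.
  by apply: (within_continuous_continuous ab cg); rewrite in_itv/= ax xb.
have [dF F'] := continuous_FTC1_closed xb gi' ax cgx.
pose F y := \int[mu]_(t in `[a, y]) g t.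
have dFx : is_derive x 1 F (g x).
  by apply: DeriveDef; [exact: dF|rewrite -derive1E; exact: F'].
have dfF : is_derive x 1 (fun y => f a + F y) (0 + g x).
  by apply: is_deriveD.
rewrite add0r in dfF; apply: near_eq_is_derive dfF; near=> y.
have yab : a <= y <= b.
  by apply/andP; split; apply/ltW; near: y; [exact: lt_nbhsr|exact: lt_nbhsl].
rewrite (fE y)//; congr (_ + _); rewrite /F /Rintegral integral_itv_bndoo//.
have /andP[_ yb] := yab.
by move/integrableP : (integrable_itv_oo_sub yb gi) => [].
Unshelve. all: by end_near. Qed.

Lemma abscont_cvg_right a b f g : a < b -> abscont a b f g -> f x @[x --> a^'+] --> f a.
Proof.
by move=> ab /(abscont_within_continuous (ltW ab)) /(continuous_within_itvP _ ab)[].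
Qed.

(** The second weak derivative makes [dtau] continuous, so [tau] is differentiable at every t > 0
    and not merely almost everywhere. The interval up to [t + 1] has t in its interior. *)
Lemma W2oo_is_derive tau dtau t : (forall T, 0 < T -> W2oo 0 T tau dtau) ->
  0 < t -> is_derive t 1 tau (dtau t).
Proof.
move=> H t0; have T0 : 0 < t + 1 by rewrite addr_gt0.
have [h1 [dd h2]] := H _ T0.
apply: (abscont_is_derive (a := 0) (b := t + 1));
  first exact: sobolev_derivativeoo_abscont.
  exact: abscont_within_continuous (ltW T0) (sobolev_derivativeoo_abscont h2).
by rewrite t0 ltrDl/=.
Qed.

Lemma W2oo_cvg_right tau dtau : (forall T, 0 < T -> W2oo 0 T tau dtau) ->
  tau t @[t --> (0 : R)^'+] --> tau 0.
Proof.
move=> /(_ 1 ltr01)[/sobolev_derivativeoo_abscont h _].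
exact: abscont_cvg_right ltr01 h.
Qed.

(** The function [V s * expR (lam * s)] has nonpositive derivative for s > 0. The inequality holds
    only there, and the right limit extends the monotonicity to the endpoint 0. *)
Lemma gronwall_expR (V : R -> R) (lam : R) :
  (forall t, 0 < t ->
    exists2 v, is_derive t (1 : R) V v & v <= - (lam * V t)) ->
  V t @[t --> (0 : R)^'+] --> V 0 ->
  forall t, 0 <= t -> V t <= V 0 * expR (- (lam * t)).
Proof.
move=> HV V0 t; pose V' s := 'D_(1 : R) V s.
have dV (s : R) : 0 < s -> is_derive s (1 : R) V (V' s).
  by move=> /HV[v d _]; apply: DeriveDef.
have V'le s : 0 < s -> V' s <= - (lam * V s).
  by move=> /HV[v d]; rewrite /V' derive_val.
rewrite le_eqVlt => /predU1P[<-|t0].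
  by rewrite mulr0 oppr0 expR0 mulr1.
pose W s := V s * expR (lam * s).
have dexp (s : R) :
    is_derive s (1 : R) (fun s => expR (lam * s)) (lam * expR (lam * s)).
  have d : is_derive s (1 : R) (fun s => lam * s) lam.
    have : is_derive s (1 : R) (lam *: id) (lam *: 1) by apply: is_deriveZ.
    by rewrite [lam *: 1]mulr1.
  by have := is_derive1_comp (is_derive_expR (lam * s)) d; rewrite mulrC.
have dW (s : R) : 0 < s ->
    is_derive s (1 : R) W (V s *: (lam * expR (lam * s)) + expR (lam * s) *: V' s).
  by move=> s0; have d := dV _ s0; apply: is_deriveM.
have W0 : W 0 = V 0 by rewrite /W mulr0 expR0 mulr1.
have cW : {within `[0, t], continuous W}.
  apply/(continuous_within_itvP _ t0); split.
  - by move=> s; rewrite in_itv/= => /andP[s0 _]; exact: is_derive_cvg (dW _ s0).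
  - apply: cvgM => //; apply/cvg_at_right_filter.
    exact: (is_derive_cvg (dexp 0)).
  - by apply/cvg_at_left_filter; exact: (is_derive_cvg (dW _ t0)).
have Wt : W t <= W 0.
  apply: (@ler0_derive1_le_cc _ W 0 t) => //.
  - by move=> s; rewrite in_itv/= => /andP[s0 _]; have d := dW _ s0.
  - move=> s; rewrite in_itv/= => /andP[s0 _]; have d := dW _ s0.
    rewrite derive1E derive_val /GRing.scale/=.
    have := V'le _ s0; have := expR_gt0 (lam * s).
    move: (expR _) => e e0 h; nra.
  - by rewrite in_itv/= lexx ltW.
  - by rewrite in_itv/= lexx ltW.
  - exact: ltW.
rewrite W0 in Wt; rewrite expRN.
by rewrite ler_pdivlMr ?expR_gt0.
Qed.

End delay.

(** * The Lyapunov functional *)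

Section states.
Context {R : realType}.
Notation mu := (@lebesgue_measure R).
Implicit Types (L t : R) (u v : state R).

Definition L2H L u : Prop :=
  [/\ L2 0 L u.1.1, L2 0 L u.1.2 & L2 0 1 u.2].

Lemma inH_L2H L u : inH L u -> L2H L u.
Proof. by move=> [h1 h2 h3]; split; exact: Lp2_L2. Qed.

Lemma L2H_sub L u v : L2H L u -> L2H L v -> L2H L (u - v).
Proof.
move=> [h1 h2 h3] [k1 k2 k3].
by split; [exact: (L2_sub h1 k1)|exact: (L2_sub h2 k2)|exact: (L2_sub h3 k3)].
Qed.

Lemma L2H_scale L (c : R) u : L2H L u -> L2H L (c *: u).
Proof.
move=> [h1 h2 h3].
by split; [exact: (L2_scale c h1)|exact: (L2_scale c h2)|exact: (L2_scale c h3)].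
Qed.

Lemma Rintegral_sqrD a b (f g : R -> R) : L2 a b f -> L2 a b g ->
  \int[mu]_(x in `]a, b[) (f x ^+ 2 + g x ^+ 2) = nrm a b f + nrm a b g.
Proof. by move=> [_ fi] [_ gi]; rewrite RintegralD// !nrmE. Qed.

Lemma sqnormHE L u : L2H L u ->
  sqnormH L u = nrm 0 L u.1.1 + nrm 0 L u.1.2 + nrm 0 1 u.2.
Proof. by move=> [h1 h2 h3]; rewrite /sqnormH Rintegral_sqrD// -nrmE. Qed.

Lemma sqnormH_cvg {T : Type} (F : set_system T) {FF : Filter F} L (u : T -> state R) :
  (\forall i \near F, L2H L (u i)) -> sqnormH L (u i) @[i --> F] --> (0 : R) ->
  [/\ nrm 0 L (u i).1.1 @[i --> F] --> (0 : R),
      nrm 0 L (u i).1.2 @[i --> F] --> (0 : R) &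
      nrm 0 1 (u i).2 @[i --> F] --> (0 : R)].
Proof.
move=> Hu u0; split; apply: (squeeze_cvgr _ (cvg_cst 0) u0); apply: filterS Hu => i Hi;
  rewrite sqnormHE// nrm_ge0/=.
- by rewrite -addrA lerDl addr_ge0 ?nrm_ge0.
- by rewrite addrAC lerDr addr_ge0 ?nrm_ge0.
- by rewrite lerDr addr_ge0 ?nrm_ge0.
Qed.

Definition lyapunov L (beta mu1 mu2 : R) (tau : R -> R) (U : R -> state R) t : R :=
  2^-1 * ip 0 L (fun=> 1) (U t).1.1 (U t).1.1 +
  2^-1 * ip 0 L (fun=> 1) (U t).1.2 (U t).1.2 +
  mu1 * ip 0 L id (U t).1.1 (U t).1.2 +
  `|beta| / 2 * (tau t * ip 0 1 (delay_weight mu2) (U t).2 (U t).2).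

Lemma energyE L (beta : R) (tau : R -> R) (U : R -> state R) t : L2H L (U t) ->
  energy L beta tau U t = 2^-1 * (nrm 0 L (U t).1.1 + nrm 0 L (U t).1.2) +
    `|beta| / 2 * (tau t * nrm 0 1 (U t).2).
Proof. by move=> [h1 h2 h3]; rewrite /energy Rintegral_sqrD// -nrmE mulrA. Qed.

Lemma energy_ge0 L (beta : R) (tau : R -> R) (U : R -> state R) t : L2H L (U t) ->
  0 <= tau t -> 0 <= energy L beta tau U t.
Proof. by move=> h t0; rewrite energyE// addr_ge0 ?mulr_ge0 ?addr_ge0 ?nrm_ge0. Qed.

Lemma ip_id_le L (f g : R -> R) : 0 < L -> L2 0 L f -> L2 0 L g ->
  `|ip 0 L id f g| <= L / 2 * (nrm 0 L f + nrm 0 L g).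
Proof.
move=> L0 Hf Hg; have := ip_young (weight_id L) ltr01 (ltW L0) Hf Hg.
by rewrite invr1 !mul1r.
Qed.

Lemma ip_delay_weight (mu2 : R) (f : R -> R) : 0 <= mu2 -> L2 0 1 f ->
  nrm 0 1 f <= ip 0 1 (delay_weight mu2) f f <= (1 + mu2) * nrm 0 1 f.
Proof.
move=> m0 Hf; have i1 := ip_integrable (weight1 0 1) Hf Hf.
have i2 := ip_integrable (weight_delay m0) Hf Hf.
have i3 := integrable_scale (1 + mu2) i1.
apply/andP; split.
  apply: le_Rintegral => // x; rewrite /= in_itv/= => /andP[x0 x1].
  rewrite /delay_weight ler_wpM2r -?expr2 ?sqr_ge0//; nra.
rewrite /nrm /ip -RintegralZl//; apply: le_Rintegral => // x.
rewrite /= in_itv/= => /andP[x0 x1]; rewrite mul1r.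
rewrite /delay_weight ler_wpM2r -?expr2 ?sqr_ge0//; nra.
Qed.

(** The cross term is at most [mu1 * L] times the interior energy, and the delay weight lies between
    1 and [1 + mu2]; a common bound [m] serves both blocks. *)
Lemma lyapunov_bounds L (beta mu1 mu2 m : R) (tau : R -> R) (U : R -> state R) t :
  0 < L -> 0 <= mu1 -> 0 <= mu2 -> 0 <= tau t -> L2H L (U t) ->
  mu1 * L <= m -> mu2 <= m ->
  (1 - m) * energy L beta tau U t <= lyapunov L beta mu1 mu2 tau U t
    <= (1 + m) * energy L beta tau U t.
Proof.
move=> L0 m1 m2 t0 HU mm1 mm2; rewrite energyE//; have [h1 h2 h3] := HU.
rewrite /lyapunov -/(nrm 0 L _) -/(nrm 0 L (U t).1.2).
have := ip_id_le L0 h1 h2; rewrite ler_norml => /andP[].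
have /andP[] := ip_delay_weight m2 h3.
have := nrm_ge0 0 L (U t).1.1; have := nrm_ge0 0 L (U t).1.2.
have := nrm_ge0 0 1 (U t).2.
have m0 : 0 <= m by rewrite (le_trans m2).
move: (nrm 0 L _) (nrm 0 L _) (nrm 0 1 _) (ip 0 L id _ _) (ip 0 1 _ _ _).
move=> a b c p q c0 b0 a0 q1 q2 p1 p2.
have k0 : 0 <= `|beta| / 2 * tau t by rewrite mulr_ge0.
rewrite !mulrA.
have ab0 : 0 <= a + b by rewrite addr_ge0.
have mp : `|mu1 * p| <= m * (2^-1 * (a + b)).
  have : `|p| <= L / 2 * (a + b) by rewrite ler_norml p1.
  move=> /(ler_wpM2l m1); rewrite normrM (ger0_norm m1) => /le_trans; apply.
  have := ler_wpM2r ab0 mm1; lra.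
move: mp; rewrite ler_norml => /andP[mp1 mp2].
move: (`|beta| / 2 * tau t) k0 => k k0.
have kq1 := ler_wpM2l k0 q1; have kq2 := ler_wpM2l k0 q2.
have kc : 0 <= k * c by rewrite mulr_ge0.
have mkc := ler_wpM2r kc mm2; have mkc0 := mulr_ge0 m0 kc.
apply/andP; split; lra.
Qed.

(* The boundary terms form a quadratic form in (eta_x(t,L), z(t,1)); the
   condition on the gains is its positivity for mu1 = mu2 = 0. *)
Lemma boundary_form (L d alpha beta : R) : 0 < L -> 0 < d -> d < 1 ->
  `|beta| < (2 * alpha - `|beta|) * (1 - d) ->
  exists2 m, 0 < m & forall mu1 mu2 a b c : R, 0 < mu1 <= m -> 0 < mu2 <= m ->
    c = - alpha * a + beta * b ->
    a * c + mu1 * (L / 2 * (a ^+ 2 + c ^+ 2)) +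
      `|beta| / 2 * (- (1 - d) * b ^+ 2 + (1 + mu2) * a ^+ 2) <= 0.
Proof.
move=> L0 d0 d1 gains.
set k : R := `|beta|; have k0 : 0 <= k by exact: normr_ge0.
have k2 : beta ^+ 2 = k ^+ 2 by rewrite real_normK ?num_real.
(* For zero multipliers, minus twice the form is [p a^2 - 2 beta a b + k q b^2], whose discriminant
   is nonpositive when [k <= p q]. The gain condition makes this strict and leaves the margin
   [p q - k]. *)
pose q : R := 1 - d; have q0 : 0 < q by rewrite subr_gt0.
pose p := 2 * alpha - k.
have gpq : k < p * q by [].
have p0 : 0 < p by rewrite -(pmulr_lgt0 _ q0) (le_lt_trans k0).
(* Apart from the final 1, which ensures positivity, [D] is the coefficient of [m] in the bound on
   the perturbation [c1 q + c2 p]; dividing the margin by [D] keeps that perturbation within it. *)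
pose D := (L * (1 + 2 * alpha ^+ 2) + k) * q + 2 * L * k * p + 1.
have A0 : 0 <= L * (1 + 2 * alpha ^+ 2).
  by rewrite mulr_ge0 ?(ltW L0)// addr_ge0// mulr_ge0// sqr_ge0.
have D0 : 0 < D.
  have B0 : 0 <= (L * (1 + 2 * alpha ^+ 2) + k) * q.
    by apply: mulr_ge0; [exact: addr_ge0|exact: ltW].
  have C0 : 0 <= 2 * L * k * p by rewrite !mulr_ge0// ltW.
  by rewrite ltr_pwDr// addr_ge0.
exists ((p * q - k) / D); first by rewrite divr_gt0 ?subr_gt0.
move=> m1 m2 a b c /andP[m10 m1m] /andP[m20 m2m] cE.
(* After [c^2] is bounded by [cle], the multipliers lower the coefficient of [a^2] from [p] to
   [p - c1] and that of [b^2] from [k q] to [k (q - c2)]. *)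
pose c1 := m1 * (L * (1 + 2 * alpha ^+ 2)) + m2 * k.
pose c2 := m1 * (2 * L * k).
have Dm : D * ((p * q - k) / D) = p * q - k by rewrite mulrC divfK ?gt_eqF.
set m := (p * q - k) / D in m1m m2m Dm.
have c10 : 0 <= c1 by rewrite addr_ge0// mulr_ge0// ltW.
have c20 : 0 <= c2 by rewrite mulr_ge0 ?(ltW m10)// !mulr_ge0// ltW.
have h1 : c1 * q <= m * ((L * (1 + 2 * alpha ^+ 2) + k) * q).
  rewrite mulrA ler_wpM2r ?(ltW q0)// mulrDr lerD// ler_wpM2r//.
have h2 : c2 * p <= m * (2 * L * k * p).
  by rewrite mulrA ler_wpM2r ?(ltW p0)// ler_wpM2r// !mulr_ge0// ltW.
have m0 : 0 < m by rewrite (lt_le_trans m10).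
have h : c1 * q + c2 * p <= p * q - k.
  rewrite -Dm /D; nra.
have Pq : 0 <= p - c1.
  rewrite subr_ge0 -(ler_pM2r q0); have := mulr_ge0 c20 (ltW p0); lra.
have Qp : 0 <= q - c2.
  rewrite subr_ge0 -(ler_pM2r p0); have := mulr_ge0 c10 (ltW q0); lra.
have PQ : k <= (p - c1) * (q - c2).
  have := mulr_ge0 c10 c20; nra.
have cle : c ^+ 2 <= 2 * alpha ^+ 2 * a ^+ 2 + 2 * k ^+ 2 * b ^+ 2.
  rewrite -k2 cE; have := sqr_ge0 (- alpha * a - beta * b); nra.
have form : 0 <= (p - c1) * a ^+ 2 - 2 * (beta * (a * b)) + k * (q - c2) * b ^+ 2.
  (* If the coefficient of [a^2] vanishes, [PQ] forces [beta = 0]; otherwise the form is multiplied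
     by this coefficient and the square is completed. *)
  move: Pq; rewrite le_eqVlt => /predU1P[P0|P0].
    have kz : k = 0 by apply/eqP; rewrite eq_le k0 andbT (le_trans PQ)// -P0 mul0r.
    have bz : beta = 0 by apply/eqP; rewrite -normr_eq0 -/k kz.
    by rewrite -P0 kz bz !mul0r mulr0 subrr add0r.
  rewrite -(pmulr_rge0 _ P0).
  have := sqr_ge0 ((p - c1) * a - beta * b).
  have : 0 <= k * ((p - c1) * (q - c2) - k) * b ^+ 2.
    by rewrite mulr_ge0 ?sqr_ge0// mulr_ge0// subr_ge0.
  rewrite sqrrB exprMn (exprMn _ beta b) k2; lra.
have mL : 0 <= m1 * L / 2 by rewrite !mulr_ge0// ltW.
have := ler_wpM2l mL cle.
have ac : a * c = - alpha * a ^+ 2 + beta * (a * b) by rewrite cE; ring.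
rewrite ac.
move: form; rewrite /c1 /c2 /p /q.
move: (c ^+ 2) => c'; lra.
Qed.

End states.

(** * Exponential decay *)

Section decay.
Context {R : realType}.
Notation mu := (@lebesgue_measure R).
Variables (L M d alpha beta : R) (tau dtau : R -> R).
Hypotheses (L_gt0 : 0 < L) (M_gt0 : 0 < M) (d_gt0 : 0 < d) (d_lt1 : d < 1).
Hypothesis tau0_gt0 : 0 < tau 0.
Hypothesis tau_bound : forall t, 0 <= t -> tau 0 <= tau t <= M.
Hypothesis dtau_le : forall t, 0 <= t -> dtau t <= d.
Hypothesis tau_W2oo : forall T, 0 < T -> W2oo 0 T tau dtau.

Lemma tau_gt0 (t : R) : 0 <= t -> 0 < tau t.
Proof. by move=> /tau_bound/andP[/(lt_le_trans tau0_gt0)]. Qed.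

Lemma generator_L2H (t : R) (u v : state R) : 0 <= t -> L2H L u ->
  generator L alpha beta tau dtau t u v -> L2H L v.
Proof.
case: u => -[eta omega] z t0 _.
move=> [e1 [e2 [e3 [w1 [w2 [w3 [z1]]]]]]].
move=> [[[He1 He2 He3] [Ho1 Ho2 Ho3] Hz] _ _ ->].
have L1 f g : sobolev_derivative 2%:E 0 L f g -> L2 0 L g by case=> /Lp2_L2.
split=> /=; [exact: L2_oppB (L1 _ _ Ho1) (L1 _ _ Ho3)|
  exact: L2_oppB (L1 _ _ He1) (L1 _ _ He3)|].
by case: Hz => /Lp2_L2/L2_transport.
Qed.

(** * Decay of the Lyapunov functional at a prescribed rate *)

Section rate.
Variables (mu1 mu2 lam : R).
Hypotheses (mu1_gt0 : 0 < mu1) (mu2_gt0 : 0 < mu2) (lam_ge0 : 0 <= lam).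
(** The price of [V' <= - lam V] in each block: on the left the upper bound of V, with [1 + mu1 L]
    from the cross term and [1 + mu2], [M] from the delay term; on the right the damping, where
    Wirtinger's inequality accounts for [(pi / L)^2]. *)
Hypothesis lam_interior :
  lam * (1 + mu1 * L) <= mu1 * (3 * (pi / L) ^+ 2 - 1).
Hypothesis lam_delay : lam * (1 + mu2) * M <= mu2 * (1 - d).
Hypothesis boundary_le0 : forall a b c : R, c = - alpha * a + beta * b ->
  a * c + mu1 * (L / 2 * (a ^+ 2 + c ^+ 2)) +
    `|beta| / 2 * (- (1 - d) * b ^+ 2 + (1 + mu2) * a ^+ 2) <= 0.

(** The left-hand side is the time derivative of V with [v] in place of [U'(t)]. The flux and
    multiplier identities remove all higher derivatives, so that the remaining inequality is linear
    in squared norms and boundary terms. *)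
Lemma lyapunov_dissipation (t : R) (U : R -> state R) (v : state R) : 0 <= t ->
  L2H L (U t) -> generator L alpha beta tau dtau t (U t) v ->
  ip 0 L (fun=> 1) (U t).1.1 v.1.1 + ip 0 L (fun=> 1) (U t).1.2 v.1.2 +
  mu1 * (ip 0 L id v.1.1 (U t).1.2 + ip 0 L id (U t).1.1 v.1.2) +
  `|beta| / 2 * (tau t * (2 * ip 0 1 (delay_weight mu2) (U t).2 v.2) +
     dtau t * ip 0 1 (delay_weight mu2) (U t).2 (U t).2)
  <= - (lam * lyapunov L beta mu1 mu2 tau U t).
Proof.
move=> t0 HU; have tau0 := tau_gt0 t0.
have /andP[_ tauM] := tau_bound t0; have dtaud := dtau_le t0.
rewrite /lyapunov; case: (U t) HU => -[eta omega] z /= [/= Leta Lomega Lz].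
move=> [e1 [e2 [e3 [w1 [w2 [w3 [z1]]]]]]].
move=> [[[He1 He2 He3] [Ho1 Ho2 Ho3] Hz] [eta0 etaL omega0 omegaL]].
move=> [e10 z0 w1L] -> /=.
have Le1 : L2 0 L e1 by case: He1 => /Lp2_L2.
have Lo1 : L2 0 L w1 by case: Ho1 => /Lp2_L2.
have Le3 : L2 0 L e3 by case: He3 => /Lp2_L2.
have Lo3 : L2 0 L w3 by case: Ho3 => /Lp2_L2.
have Lz1 : L2 0 1 z1 by case: Hz => /Lp2_L2.
move/sobolev_derivative_abscont in He1; move/sobolev_derivative_abscont in He2.
move/sobolev_derivative_abscont in He3; move/sobolev_derivative_abscont in Ho1.
move/sobolev_derivative_abscont in Ho2; move/sobolev_derivative_abscont in Ho3.
move/sobolev_derivative_abscont in Hz.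
have S1 := energy_flux L_gt0 He1 He2 He3 Le3 Ho1 Ho2 Ho3 Lo3
  eta0 etaL omega0 omegaL e10.
have S2 := multiplier_identity L_gt0 He1 He2 He3 Le3 eta0 etaL.
have S3 := multiplier_identity L_gt0 Ho1 Ho2 Ho3 Lo3 omega0 omegaL.
have S4 := delay_flux (dtau t) (ltW mu2_gt0) (lt0r_neq0 tau0) Hz Lz1.
rewrite [X in mu1 * (X + _)]ipC S1 S2 S3 S4 z0.
have W1 := wirtinger L_gt0 He1 Le1 eta0 etaL.
have W2 := wirtinger L_gt0 Ho1 Lo1 omega0 omegaL.
have := ip_id_le L_gt0 Leta Lomega; rewrite ler_norml => /andP[_ P1].
have /andP[_ P2] := ip_delay_weight (ltW mu2_gt0) Lz.
(* Since [dtau t] may be negative, the bound goes through [d * x], which is at most [d] because d >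
   0. *)
have J : ip 0 1 (fun x => dtau t * x - 1) z z <= - (1 - d) * nrm 0 1 z.
  have i1 := ip_integrable (weight1 0 1) Lz Lz.
  have i2 := ip_integrable (weight_transport (dtau t)) Lz Lz.
  rewrite /nrm /ip -RintegralZl//; apply: le_Rintegral => //.
    exact: integrable_scale.
  move=> x; rewrite /= in_itv/= => /andP[x0 x1]; rewrite mul1r.
  have h1 : dtau t * x <= d * x by rewrite ler_wpM2r// ltW.
  have h2 : d * x <= d by rewrite ler_piMr// ltW.
  by rewrite ler_wpM2r -?expr2 ?sqr_ge0//; lra.
have B := boundary_le0 w1L.
have K0 : 0 <= `|beta| / 2 by rewrite mulr_ge0.
have n1 := nrm_ge0 0 L eta; have n2 := nrm_ge0 0 L omega; have n3 := nrm_ge0 0 1 z.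
rewrite -/(nrm 0 L eta) -/(nrm 0 L omega).
move: (`|beta| / 2) K0 B => K K0 B.
set q := ip 0 1 (delay_weight mu2) z z in P2 *.
set p := ip 0 L id eta omega in P1 *.
set j := ip 0 1 _ z z in J *.
move: (nrm 0 L eta) (nrm 0 L omega) (nrm 0 1 z) (nrm 0 L e1) (nrm 0 L w1)
  n1 n2 n3 W1 W2 P1 P2 J => A B' C A1 B1 n1 n2 n3 W1 W2 P1 P2 J.
move: lam_interior; move: ((pi / L) ^+ 2) W1 W2 => P W1 W2 lamP.
move: (e1 L) (z 1 : R) (w1 L) B => a b c B.
have Kb : K * ((dtau t - 1) * b ^+ 2) <= K * (- (1 - d) * b ^+ 2).
  by rewrite ler_wpM2l// ler_wpM2r ?sqr_ge0//; lra.
have KJ : K * (mu2 * j) <= K * (mu2 * (- (1 - d) * C)).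
  by rewrite ler_wpM2l// ler_wpM2l// ltW.
have AB0 : 0 <= A + B' by rewrite addr_ge0.
have I1 : lam * (1 + mu1 * L) * (A + B') <= mu1 * (3 * P - 1) * (A + B').
  by rewrite ler_wpM2r.
have I2 : K * (lam * (1 + mu2) * tau t * C) <= K * (mu2 * (1 - d) * C).
  rewrite ler_wpM2l// ler_wpM2r// (le_trans _ lam_delay)// ler_wpM2l//.
  by rewrite mulr_ge0// addr_ge0// ltW.
have I3 : lam * (mu1 * p) <= lam * (mu1 * (L / 2 * (A + B'))).
  by rewrite ler_wpM2l// ler_wpM2l// ltW.
have I4 : lam * (K * (tau t * q)) <= lam * (K * (tau t * ((1 + mu2) * C))).
  by rewrite ler_wpM2l// ler_wpM2l// ler_wpM2l// ltW.
have I5 : mu1 * (P * A) <= mu1 * A1 by rewrite ler_wpM2l// ltW.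
have I6 : mu1 * (P * B') <= mu1 * B1 by rewrite ler_wpM2l// ltW.
lra.
Qed.

Lemma nbhs_gt0_L2H (U : R -> state R) (t : R) : (forall s, 0 <= s -> inH L (U s)) ->
  0 < t -> \forall s \near t, L2H L (U s).
Proof.
move=> HU t0; near=> s; apply: inH_L2H; apply: HU; apply: ltW; near: s.
exact: lt_nbhsr.
Unshelve. all: by end_near. Qed.

Lemma lyapunov_is_derive (U : R -> state R) (t : R) :
  classical_solution L alpha beta tau dtau U -> 0 < t ->
  exists2 v, is_derive t (1 : R) (lyapunov L beta mu1 mu2 tau U) v &
    v <= - (lam * lyapunov L beta mu1 mu2 tau U t).
Proof.
move=> [HU _ dU] t0; have [v gen lim] := dU _ t0.
have nU := nbhs_gt0_L2H HU t0.
have HUt : L2H L (U t) by exact/inH_L2H/HU/ltW.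
have Hv := generator_L2H (ltW t0) HUt gen.
have nq : \forall h \near (0 : R)^', L2H L (h^-1 *: (U (t + h) - U t) - v).
  apply: filterS (dnbhs0_shift nU) => h Hh.
  by apply: L2H_sub => //; apply: L2H_scale; exact: L2H_sub.
have [l1 l2 l3] := sqnormH_cvg nq lim.
have n1 : \forall s \near t, L2 0 L (U s).1.1 by apply: filterS nU => s [].
have n2 : \forall s \near t, L2 0 L (U s).1.2 by apply: filterS nU => s [].
have n3 : \forall s \near t, L2 0 1 (U s).2 by apply: filterS nU => s [].
have [v1 v2 v3] := Hv.
have d1 := ip_is_derive (weight1 0 L) n1 n1 v1 v1 l1 l1.
have d2 := ip_is_derive (weight1 0 L) n2 n2 v2 v2 l2 l2.
have d3 := ip_is_derive (weight_id L) n1 n2 v1 v2 l1 l2.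
have d4 := ip_is_derive (weight_delay (ltW mu2_gt0)) n3 n3 v3 v3 l3 l3.
have d5 := W2oo_is_derive tau_W2oo t0.
have D := is_deriveD (is_deriveD (is_deriveD (is_deriveZ 2^-1 d1)
  (is_deriveZ 2^-1 d2)) (is_deriveZ mu1 d3)) (is_deriveZ (`|beta| / 2)
  (is_deriveM d5 d4)).
eexists; first exact: D.
apply: le_trans (lyapunov_dissipation (ltW t0) HUt gen).
rewrite ![ip _ _ _ v.1.1 (U t).1.1]ipC ![ip _ _ _ v.1.2 (U t).1.2]ipC.
rewrite ![ip _ _ _ v.2 (U t).2]ipC /GRing.scale/=.
rewrite le_eqVlt; apply/orP; left; apply/eqP.
by rewrite /delay_weight; field.
Qed.

Lemma lyapunov_cvg_right (U : R -> state R) :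
  classical_solution L alpha beta tau dtau U ->
  lyapunov L beta mu1 mu2 tau U t @[t --> (0 : R)^'+] -->
    lyapunov L beta mu1 mu2 tau U 0.
Proof.
move=> [HU cU _]; have H0 : L2H L (U 0) by exact/inH_L2H/HU.
have c0 : sqnormH L (U s - U 0) @[s --> (0 : R)^'+] --> (0 : R).
  apply: cvg_trans (cU 0 (lexx _)); apply: cvg_app => A HA.
  have HA' : nbhs (0 : R) (fun x => 0 <= x -> A x) := HA.
  suff : nbhs (0 : R) (fun x => 0 < x -> A x) by [].
  by apply: filterS HA' => x h x0; apply: h; exact: ltW.
have nU : \forall s \near (0 : R)^'+, L2H L (U s).
  by near=> s; apply/inH_L2H/HU.
have nq : \forall s \near (0 : R)^'+, L2H L (U s - U 0).
  by apply: filterS nU => s Hs; exact: L2H_sub.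
have [l1 l2 l3] := sqnormH_cvg nq c0.
have n1 : \forall s \near (0 : R)^'+, L2 0 L (U s).1.1 by apply: filterS nU => s [].
have n2 : \forall s \near (0 : R)^'+, L2 0 L (U s).1.2 by apply: filterS nU => s [].
have n3 : \forall s \near (0 : R)^'+, L2 0 1 (U s).2 by apply: filterS nU => s [].
have [v1 v2 v3] := H0.
apply: cvgD; [apply: cvgD; [apply: cvgD|]|]; (apply: cvgM; first exact: cvg_cst).
- exact: (ip_cvg (weight1 0 L)).
- exact: (ip_cvg (weight1 0 L)).
- exact: (ip_cvg (weight_id L)).
- apply: cvgM; first exact: (W2oo_cvg_right tau_W2oo).
  exact: (ip_cvg (weight_delay (ltW mu2_gt0))).
Unshelve. all: by end_near. Qed.

Lemma lyapunov_decay (U : R -> state R) (t : R) :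
  classical_solution L alpha beta tau dtau U -> 0 <= t ->
  lyapunov L beta mu1 mu2 tau U t <=
    lyapunov L beta mu1 mu2 tau U 0 * expR (- (lam * t)).
Proof.
move=> HU; apply: gronwall_expR => [s s0|]; first exact: lyapunov_is_derive.
exact: lyapunov_cvg_right.
Qed.

Lemma energy_decay_classical (U : R -> state R) (t : R) :
  mu1 * L < 1 -> mu2 < 1 ->
  classical_solution L alpha beta tau dtau U -> 0 <= t ->
  energy L beta tau U t <=
    decay_constant L mu1 mu2 * energy L beta tau U 0 * expR (- (lam * t)).
Proof.
move=> m1 m2 HU t0; have [HU0 _ _] := HU.
pose m := Num.max (mu1 * L) mu2.
have mm1 : mu1 * L <= m by rewrite le_max lexx.
have mm2 : mu2 <= m by rewrite le_max lexx orbT.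
have mlt1 : 0 < 1 - m by rewrite subr_gt0 gt_max m1 m2.
have bd s : 0 <= s -> (1 - m) * energy L beta tau U s <=
    lyapunov L beta mu1 mu2 tau U s <= (1 + m) * energy L beta tau U s.
  move=> s0; apply: lyapunov_bounds => //; rewrite ?ltW ?tau_gt0//.
  exact/inH_L2H/HU0.
have /andP[lo _] := bd _ t0; have /andP[_ hi] := bd _ (lexx 0).
rewrite /decay_constant -/m -(ler_pM2l mlt1) (le_trans lo)//.
rewrite (le_trans (lyapunov_decay HU t0))//.
rewrite [leRHS](_ : _ = (1 + m) * energy L beta tau U 0 * expR (- (lam * t))).
  by rewrite ler_wpM2r ?expR_ge0.
by field; rewrite gt_eqF.
Qed.

Lemma energy_cvg (Un : nat -> R -> state R) (U : R -> state R) (t : R) : 0 <= t ->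
  L2H L (U t) -> (forall n, L2H L (Un n t)) ->
  sqnormH L (Un n t - U t) @[n --> \oo] --> (0 : R) ->
  energy L beta tau (Un n) t @[n --> \oo] --> energy L beta tau U t.
Proof.
move=> t0 HU Hn lim.
have [l1 l2 l3] : [/\ nrm 0 L (Un n t - U t).1.1 @[n --> \oo] --> (0 : R),
    nrm 0 L (Un n t - U t).1.2 @[n --> \oo] --> (0 : R) &
    nrm 0 1 (Un n t - U t).2 @[n --> \oo] --> (0 : R)].
  by apply: sqnormH_cvg => //; apply: nearW => n; exact: L2H_sub.
rewrite energyE//; under eq_fun do rewrite energyE//.
have [v1 v2 v3] := HU.
have c1 : nrm 0 L (Un n t).1.1 @[n --> \oo] --> nrm 0 L (U t).1.1.
  by apply: (ip_cvg (weight1 0 L)) => //; apply: nearW => n; have [] := Hn n.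
have c2 : nrm 0 L (Un n t).1.2 @[n --> \oo] --> nrm 0 L (U t).1.2.
  by apply: (ip_cvg (weight1 0 L)) => //; apply: nearW => n; have [] := Hn n.
have c3 : nrm 0 1 (Un n t).2 @[n --> \oo] --> nrm 0 1 (U t).2.
  by apply: (ip_cvg (weight1 0 1)) => //; apply: nearW => n; have [] := Hn n.
by apply: cvgD; (apply: cvgM; first exact: cvg_cst);
  [exact: cvgD|apply: cvgM; first exact: cvg_cst].
Qed.

Lemma exponential_decay_rate : mu1 * L < 1 -> mu2 < 1 ->
  exponential_decay L alpha beta tau dtau (decay_constant L mu1 mu2) lam.
Proof.
move=> m1 m2 eta0 omega0 z0 U u0 _ [HU _ [Un Hcl Hcv]] t t0.
have lim s : 0 <= s ->
    energy L beta tau (Un n) s @[n --> \oo] --> energy L beta tau U s.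
  move=> s0; apply: energy_cvg => //; first exact/inH_L2H/HU.
    by move=> n; have [Hn _ _] := Hcl n; exact/inH_L2H/Hn.
  (* The horizon [s + 1] is positive even for s = 0, where convergence of the initial energies is
     needed. *)
  apply/cvgrPdist_le => e e0; have s10 : 0 < s + 1 by rewrite ltr_wpDl.
  apply: filterS (Hcv _ _ s10 e0) => n /(_ s).
  rewrite s0 lerDl ler01 => /(_ isT); rewrite sub0r normrN ger0_norm//.
  by rewrite /sqnormH addr_ge0// Rintegral_ge0// => x _;
    rewrite ?addr_ge0 ?sqr_ge0.
have c1 := lim _ t0; have c0 := lim _ (lexx 0).
set e := expR _; set zeta := decay_constant _ _ _.
have c2 : zeta * energy L beta tau (Un n) 0 * e @[n --> \oo] -->
    zeta * energy L beta tau U 0 * e.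
  apply: cvgM; last exact: cvg_cst.
  by apply: cvgM => //; exact: cvg_cst.
rewrite -(cvg_lim _ c1)// -(cvg_lim _ c2)//; apply: ler_lim.
- by apply/cvg_ex; eexists; exact: c1.
- by apply/cvg_ex; eexists; exact: c2.
- by apply: nearW => n; exact: energy_decay_classical.
Qed.

End rate.

(** By nonnegativity of the initial energy, an estimate obtained with one pair of multipliers can be
    read with the weaker constant or rate of another. *)
Lemma exponential_decay_le (zeta zeta' lam lam' : R) :
  0 <= zeta' -> zeta' <= zeta -> lam <= lam' ->
  exponential_decay L alpha beta tau dtau zeta' lam' ->
  exponential_decay L alpha beta tau dtau zeta lam.
Proof.
move=> z0 zz ll H eta0 omega0 z0' U u0 Hu0 HU t t0.
have [HUin _ _] := HU.
have E0 : 0 <= energy L beta tau U 0.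
  by apply: energy_ge0; [exact/inH_L2H/HUin|exact: ltW].
rewrite (le_trans (H _ _ _ _ Hu0 HU _ t0))//.
rewrite ler_pM ?expR_ge0 ?mulr_ge0//; first by rewrite ler_wpM2r.
by rewrite ler_expR lerN2 ler_wpM2r.
Qed.

End decay.

(** * Choice of the multipliers *)

Lemma decay_constant_le (R : realType) (L m1 m2 n1 n2 : R) : 0 < L -> 0 < m1 ->
  m1 <= n1 -> m2 <= n2 -> n1 * L < 1 -> n2 < 1 ->
  0 <= decay_constant L m1 m2 <= decay_constant L n1 n2.
Proof.
move=> L0 m10 mn1 mn2 n1L n21; rewrite /decay_constant.
set m := Num.max (m1 * L) m2; set n := Num.max (n1 * L) n2.
have mL : m1 * L <= n1 * L by rewrite ler_wpM2r// ltW.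
have mn : m <= n by rewrite ge_max !le_max mL mn2 orbT.
have n1lt : n < 1 by rewrite gt_max n1L n21.
have m0 : 0 <= m by rewrite le_max mulr_ge0// ltW.
have m1lt : m < 1 by exact: le_lt_trans n1lt.
have q1 : 0 < 1 - m by rewrite subr_gt0.
have q2 : 0 < 1 - n by rewrite subr_gt0.
move: (m) (n) mn m0 q1 q2 => p q pq p0 q1 q2.
apply/andP; split; first by apply: divr_ge0; [exact: addr_ge0|exact: ltW].
rewrite ler_pdivrMr// mulrAC ler_pdivlMr//.
have -> : (1 + q) * (1 - p) = (1 + p) * (1 - q) + 2 * (q - p) by ring.
by rewrite lerDl mulr_ge0// subr_ge0.
Qed.

(* mu2 is chosen small with respect to mu1, so that the minimum in the decay rate
   is governed by the delay: the first term of that minimum, with its 1 + mu1 in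
   place of the 1 + mu1 L coming from V <= (1 + mu1 L) E, would be too large for
   L > 1. *)
Lemma small_multipliers (R : realType) (L M d alpha beta : R) (tau dtau : R -> R)
    (n1 n2 : R) :
  0 < L -> L ^+ 2 < 3 * pi ^+ 2 -> 0 < M -> 0 < d -> d < 1 -> 0 < tau 0 ->
  (forall t, 0 <= t -> tau 0 <= tau t <= M) ->
  (forall t, 0 <= t -> dtau t <= d) ->
  (forall T, 0 < T -> W2oo 0 T tau dtau) ->
  `|beta| < (2 * alpha - `|beta|) * (1 - d) ->
  0 < n1 -> 0 < n2 ->
  exists mu1 mu2 : R, [/\ 0 < mu1 <= n1, 0 < mu2 <= n2, mu1 * L < 1, mu2 < 1 &
    0 < decay_rate L M d mu1 mu2 /\
    exponential_decay L alpha beta tau dtau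
      (decay_constant L mu1 mu2) (decay_rate L M d mu1 mu2)].
Proof.
move=> L0 Lpi M0 d0 d1 tau0 tauM dtaud tauW gains n10 n20.
have [m m0 bform] := boundary_form L0 d0 d1 gains.
have q0 : 0 < 1 - d by rewrite subr_gt0.
have gap : 0 < 3 * pi ^+ 2 - L ^+ 2 by rewrite subr_gt0.
have L20 : 0 < L ^+ 2 by rewrite exprn_gt0.
(* The three bounds are the prescribed cap, the sign of the boundary form, and [mu1 L <= 1/2]. *)
pose mu1 := Num.min (Num.min n1 m) (2 * L)^-1.
have mu10 : 0 < mu1 by rewrite !lt_min n10 m0 invr_gt0 mulr_gt0.
have mu1n : mu1 <= n1 by rewrite !ge_min lexx.
have mu1m : mu1 <= m by rewrite !ge_min lexx orbT.
have mu1L : mu1 * L < 1.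
  have : mu1 <= (2 * L)^-1 by rewrite !ge_min lexx !orbT.
  move=> /(ler_wpM2r (ltW L0)) /le_lt_trans; apply.
  by rewrite invfM mulfVK ?gt_eqF// invf_lt1// ltr1n.
(* The largest rate that the interior damping allows. *)
pose r1 := mu1 * (3 * pi ^+ 2 - L ^+ 2) / (L ^+ 2 * (1 + mu1 * L)).
have e1 : 0 < 1 + mu1 * L by rewrite addr_gt0// mulr_gt0.
have r10 : 0 < r1 by rewrite divr_gt0 ?mulr_gt0.
(* The last bound gives [mu2 (1 - d) / M <= r1], so the delay term of the decay rate, and with it
   the minimum, stays below [r1]. *)
pose mu2 := Num.min (Num.min n2 m) (Num.min 2^-1 (r1 * M / (1 - d))).
have mu20 : 0 < mu2.
  by rewrite !lt_min n20 m0 invr_gt0 ltr0n/= divr_gt0// mulr_gt0.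
have mu2n : mu2 <= n2 by rewrite !ge_min lexx.
have mu2m : mu2 <= m by rewrite !ge_min lexx orbT.
have mu21 : mu2 < 1.
  apply: (@le_lt_trans _ _ 2^-1); first by rewrite !ge_min lexx !orbT.
  by rewrite invf_lt1// ltr1n.
have mu2r : mu2 * (1 - d) <= r1 * M.
  by rewrite -ler_pdivlMr// !ge_min lexx !orbT.
have f2 : 0 < 1 + mu2 by rewrite addr_gt0.
have f1 : 0 < 1 + mu1 by rewrite addr_gt0.
have rate0 : 0 < decay_rate L M d mu1 mu2.
  by rewrite lt_min !divr_gt0 ?mulr_gt0.
have ratele : decay_rate L M d mu1 mu2 * (M * (1 + mu2)) <= mu2 * (1 - d).
  by rewrite -ler_pdivlMr ?mulr_gt0// ge_min lexx orbT.
exists mu1, mu2; split; rewrite ?mu10 ?mu20//; split => //.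
apply: (exponential_decay_rate (M := M) (d := d)) => //.
- exact: ltW.
- have rM : decay_rate L M d mu1 mu2 * M <= r1 * M.
    apply: le_trans mu2r; apply: le_trans ratele.
    by rewrite ler_pM2l//; apply: ler_peMr; rewrite ?lerDl ltW.
  rewrite (_ : mu1 * (3 * _ - 1) = r1 * (1 + mu1 * L)).
    by rewrite ler_pM2r// -(ler_pM2r M0).
  by rewrite /r1; field; rewrite !gt_eqF.
- by rewrite -mulrA (mulrC (1 + mu2)).
- by move=> a b c cE; apply: bform => //; rewrite ?mu10 ?mu20.
Qed.

(** The two conjuncts cover both readings of the quantifiers: every admissible pair of multipliers
    has a positive rate below its bound, and some pair allows every rate up to its bound. The
    condition [mu2 < 1] keeps the denominator of zeta positive. *)
Theorem theorem1p1 (R : realType) (L M d alpha beta : R) (tau dtau : R -> R)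
  (L_gt0 : 0 < L) (L_lt : L < Num.sqrt 3 * pi)
  (M_gt0 : 0 < M) (d_gt0 : 0 < d) (d_lt1 : d < 1)
  (tau0_gt0 : 0 < tau 0)
  (tau_bound : forall t, 0 <= t -> tau 0 <= tau t <= M)
  (dtau_le : forall t, 0 <= t -> dtau t <= d)
  (tau_W2oo : forall T, 0 < T -> W2oo 0 T tau dtau)
  (gains : `|beta| < (2 * alpha - `|beta|) * (1 - d)) :
  (forall mu1 mu2 : R, 0 < mu1 -> 0 < mu2 -> mu1 * L < 1 -> mu2 < 1 ->
     exists2 lambda : R, 0 < lambda <= decay_rate L M d mu1 mu2 &
       exponential_decay L alpha beta tau dtau
         (decay_constant L mu1 mu2) lambda) /\
  (exists mu1 mu2 : R, [/\ 0 < mu1, 0 < mu2, mu1 * L < 1, mu2 < 1 &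
     forall lambda : R, lambda <= decay_rate L M d mu1 mu2 ->
       exponential_decay L alpha beta tau dtau
         (decay_constant L mu1 mu2) lambda]).
Proof.
have Lpi : L ^+ 2 < 3 * pi ^+ 2.
  have -> : 3 * pi ^+ 2 = (Num.sqrt 3 * pi) ^+ 2 :> R by rewrite exprMn sqr_sqrtr.
  by rewrite ltr_pXn2r// nnegrE ?mulr_ge0 ?sqrtr_ge0 ?pi_ge0// ltW.
split.
  move=> mu1 mu2 mu10 mu20 mu1L mu21.
  (* The estimate is proved with smaller multipliers [n1], [n2]; it transfers to the given ones
     because [(1 + x) / (1 - x)] increases on [[0, 1[]. *)
  have [n1 [n2 [/andP[n10 n1m] /andP[n20 n2m] _ _ [r0 H]]]] :=
    small_multipliers L_gt0 Lpi M_gt0 d_gt0 d_lt1 tau0_gt0 tau_bound dtau_le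
      tau_W2oo gains mu10 mu20.
  (* The first rate is the one established, the second enforces the bound required of lambda; both
     are positive. *)
  exists (Num.min (decay_rate L M d n1 n2) (decay_rate L M d mu1 mu2)).
    rewrite ge_min lexx orbT andbT lt_min r0 lt_min /=.
    by rewrite !divr_gt0 ?mulr_gt0 ?subr_gt0 ?exprn_gt0 ?addr_gt0.
  have /andP[z0 zz] := decay_constant_le L_gt0 n10 n1m n2m mu1L mu21.
  by apply: (exponential_decay_le _ z0 zz _ H) => //; rewrite ge_min lexx.
have [n1 [n2 [/andP[n10 n1m] /andP[n20 n2m] n1L n21 [r0 H]]]] :=
  small_multipliers L_gt0 Lpi M_gt0 d_gt0 d_lt1 tau0_gt0 tau_bound dtau_le
    tau_W2oo gains ltr01 ltr01.
exists n1, n2; split=> // lam lamr.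
have /andP[z0 _] := decay_constant_le L_gt0 n10 (lexx n1) (lexx n2) n1L n21.
exact: (exponential_decay_le _ z0 (lexx _) lamr H).
Qed.
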